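(* Let $H\supseteq A$ be a Bäckström pair and $\tilde A$ its Auslander envelope. Then $\mathrm{der.dim}\,A\le \mathrm{der.dim}\,\tilde A$. Namely, if $D^b_f(\tilde A)=\langle\mathfrak M\rangle_{k+1}$, then $D^b_f(A)=\langle DF(\mathfrak M)\rangle_{k+1}$.
   Context: A Bäckström pair is a pair of semiperfect rings $H\supseteq A$ with $\mathrm{rad}\,A=\mathrm{rad}\,H$. The conductor is $C=\{\alpha\in A\mid H\alpha\subseteq A\}$, a two-sided $H$-ideal contained in $A$. The Auslander envelope is the matrix ring $\tilde A=\begin{pmatrix}A&H\\ C&H\end{pmatrix}$. For a ring $S$, $D(S)$ is the derived category of left $S$-modules; $D_f(S)$ is the full subcategory of complexes quasi-isomorphic to complexes of finitely generated projective modules (if $S$ is left noetherian, it is the derived category of the category of finitely generated $S$-modules), and $D_f^b(S)$ is its bounded version. Let $P=\begin{pmatrix}A\\ C\end{pmatrix}$ (the first column of $\tilde A$), a projective left $\tilde A$-module with $\mathrm{End}_{\tilde A}P\simeq A^{\mathrm{op}}$, and $F=\mathrm{Hom}_{\tilde A}(P,-):\tilde A\text{-Mod}\to A\text{-Mod}$, which is an exact functor. $DF:D(\tilde A)\to D(A)$ is $F$ applied to complexes componentwise. For a set $\mathfrak M$ of objects of a triangulated category $\mathcal T$: $\langle\mathfrak M\rangle$ is the smallest full subcategory of $\mathcal T$ containing $\mathfrak M$ and closed under direct sums, direct summands and shifts; $\mathfrak M\dagger\mathfrak N$ is the set of objects $X$ for which there is an exact triangle $Y\to Z\to X\to Y[1]$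 with $Y\in\mathfrak M$, $Z\in\mathfrak N$; $\langle\mathfrak M\rangle_1=\langle\mathfrak M\rangle$ and $\langle\mathfrak M\rangle_{k+1}=\langle\langle\mathfrak M\rangle\dagger\langle\mathfrak M\rangle_k\rangle$. The dimension $\dim\mathcal T$ is the smallest $k$ for which there is a finite set of objects $\mathfrak M$ with $\langle\mathfrak M\rangle_{k+1}=\mathcal T$ (if it exists), and $\mathrm{der.dim}\,S=\dim D_f^b(S)$.
   Formalization: Assumes in addition that DF maps D_f^b(Ã) into D_f^b(A) (automatic if Ã is left noetherian); without it the second sentence fails, e.g. A = k, H = K an infinite field extension. D_f^b means bounded cohomology and a right-bounded complex of f.g. projectives. *)

(* Defs.v *)
From HB Require Import structures.
From mathcomp Require Import all_boot all_order all_algebra.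
From mathcomp Require Import boolp.

Set Implicit Arguments.
Unset Strict Implicit.
Unset Printing Implicit Defensive.

Import GRing.Theory.
Local Open Scope ring_scope.

Section Semiperfect.
Variable S : pzRingType.
Implicit Types L : S -> Prop.

Definition left_ideal L : Prop :=
  [/\ L 0, forall x y, L x -> L y -> L (x + y) & forall a x, L x -> L (a * x)].

Definition maximal_left_ideal L : Prop :=
  [/\ left_ideal L, ~ L 1 &
      forall L', left_ideal L' -> ~ L' 1 ->
        (forall x, L x -> L' x) -> forall x, L' x -> L x].

Definition jacobson (x : S) : Prop := forall L, maximal_left_ideal L -> L x.

(* S / rad S is a semisimple ring: every submodule of the left module
   S / rad S, i.e. every left ideal containing rad S, is a direct summand. *)
Definition semisimple_mod_rad : Prop :=
  forall L, left_ideal L -> (forall x, jacobson x -> L x) ->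
  exists L', [/\ left_ideal L', forall x, jacobson x -> L' x,
    forall x, exists y z, [/\ L y, L' z & x = y + z] &
    forall x, L x -> L' x -> jacobson x].

Definition lift_idempotents : Prop :=
  forall x : S, jacobson (x * x - x) ->
  exists e : S, e * e = e /\ jacobson (e - x).

Definition semiperfect : Prop := semisimple_mod_rad /\ lift_idempotents.

End Semiperfect.

Section Subring.
Variables (H : pzRingType) (A : subringClosed H).

Record subring : Type := Subring { subring_val : H; _ : subring_val \in A }.

HB.instance Definition _ := [isSub for subring_val].
HB.instance Definition _ := [Choice of subring by <:].

Fact subring_closedP : subring_closed A.
Proof. by split=> [|x y|x y]; [exact: rpred1 | exact: rpredB | exact: rpredM]. Qed.

HB.instance Definition _ :=
  GRing.SubChoice_isSubPzRing.Build H _ subring subring_closedP.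

End Subring.

Definition backstrom_pair (H : pzRingType) (A : subringClosed H) : Prop :=
  [/\ semiperfect H, semiperfect (subring A) &
      forall x : H,
        jacobson x <-> exists a : subring A, val a = x /\ jacobson a].

Section Envelope.
Variables (H : pzRingType) (A : subringClosed H).

Definition conductor : {pred H} :=
  [pred x | (x \in A) && `[< forall h : H, h * x \in A >]].

Lemma conductorP (x : H) :
  reflect (x \in A /\ forall h : H, h * x \in A) (x \in conductor).
Proof. by apply: (iffP andP) => -[xA /asboolP hx]; split=> //; apply/asboolP. Qed.

Fact conductor0 : 0 \in conductor.
Proof. by apply/conductorP; split=> [|h]; rewrite ?mulr0 rpred0. Qed.

Fact conductorB : {in conductor &, forall x y, x - y \in conductor}.
Proof.
move=> x y /conductorP[xA hx] /conductorP[yA hy]; apply/conductorP.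
by split=> [|h]; rewrite ?mulrBr rpredB.
Qed.

Fact conductorD : {in conductor &, forall x y, x + y \in conductor}.
Proof.
move=> x y xC yC; rewrite -[y]opprK -[- y]sub0r.
by rewrite conductorB ?conductorB ?conductor0.
Qed.

Fact conductorMl (h x : H) : x \in conductor -> h * x \in conductor.
Proof.
move=> /conductorP[xA hx]; apply/conductorP.
by split=> [|h']; rewrite ?mulrA hx.
Qed.

Fact conductorMr (x a : H) : x \in conductor -> a \in A -> x * a \in conductor.
Proof.
move=> /conductorP[xA hx] aA; apply/conductorP.
by split=> [|h]; rewrite ?mulrA rpredM.
Qed.

Fact conductorMlA (h x : H) : x \in conductor -> h * x \in A.
Proof. by case/conductorP. Qed.

(* Matrices of the shape (A H; C H). *)
Definition envelope_shape : {pred 'M[H]_2} :=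
  [pred M : 'M[H]_2 |
    (M ord0 ord0 \in A) && (M ord_max ord0 \in conductor)].

Lemma sum_ord2 (V : nmodType) (f : 'I_2 -> V) :
  \sum_i f i = f ord0 + f ord_max.
Proof. by rewrite big_ord_recl big_ord1; congr (_ + f _); apply: val_inj. Qed.

Fact envelope_subring : subring_closed envelope_shape.
Proof.
split=> [|M N /andP[a c] /andP[a' c']|M N /andP[a c] /andP[a' c']];
  rewrite inE ?mxE /=; apply/andP; split.
- by rewrite rpred1.
- exact: conductor0.
- by rewrite rpredB.
- exact: conductorB.
- by rewrite sum_ord2 rpredD ?(conductorMlA _ c') // rpredM.
- by rewrite sum_ord2 conductorD ?(conductorMr c a') ?(conductorMl _ c').
Qed.

Record envelope : Type :=
  Envelope { envelope_val : 'M[H]_2; _ : envelope_val \in envelope_shape }.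

HB.instance Definition _ := [isSub for envelope_val].
HB.instance Definition _ := [Choice of envelope by <:].
HB.instance Definition _ :=
  GRing.SubChoice_isSubPzRing.Build _ _ envelope
    envelope_subring.

(* The first column P = (A; C) of the envelope. *)
Definition column_shape : {pred 'cV[H]_2} :=
  [pred v : 'cV[H]_2 |
    (v ord0 ord0 \in A) && (v ord_max ord0 \in conductor)].

Fact column_zmod : zmod_closed column_shape.
Proof.
split=> [|u v /andP[a c] /andP[a' c']]; rewrite inE /= !mxE; apply/andP; split.
- by rewrite rpred0.
- exact: conductor0.
- by rewrite rpredB.
- exact: conductorB.
Qed.

Record column : Type :=
  Column { column_val : 'cV[H]_2; _ : column_val \in column_shape }.

HB.instance Definition _ := [isSub for column_val].
HB.instance Definition _ := [Choice of column by <:].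
HB.instance Definition _ :=
  GRing.SubChoice_isSubZmodule.Build _ _ column column_zmod.

Fact column_mulP (M : envelope) (v : column) : val M *m val v \in column_shape.
Proof.
case: M v => [M /andP[a c]] [v /andP[a' c']] /=.
rewrite inE /= !mxE !sum_ord2; apply/andP; split.
- by rewrite rpredD ?(conductorMlA _ c') // rpredM.
- by rewrite conductorD ?(conductorMr c a') ?(conductorMl _ c').
Qed.

Definition column_scale (M : envelope) (v : column) : column :=
  Sub (val M *m val v) (column_mulP M v).

Fact column_scaleA a b v :
  column_scale a (column_scale b v) = column_scale (a * b) v.
Proof. by apply: val_inj; rewrite /= mulmxA. Qed.
Fact column_scale1 : left_id 1 column_scale.
Proof. by move=> v; apply: val_inj; rewrite /= mul1mx. Qed.
Fact column_scaleDr : right_distributive column_scale +%R.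
Proof. by move=> a u v; apply: val_inj; rewrite /= mulmxDr. Qed.
Fact column_scaleDl v : {morph column_scale^~ v : a b / a + b}.
Proof. by move=> a b; apply: val_inj; rewrite /= mulmxDl. Qed.

HB.instance Definition _ := GRing.Zmodule_isLmodule.Build envelope column
  column_scaleA column_scale1 column_scaleDr column_scaleDl.

(* The right action of A on P, i.e. the isomorphism End P = A^op. *)
Fact column_rmulP (v : column) (a : subring A) :
  map_mx (fun x => x * val a) (val v) \in column_shape.
Proof.
case: v a => [v vP] [a aA]; case/andP: (vP) => c c'.
rewrite inE /= !mxE; apply/andP; split.
- by rewrite rpredM.
- exact: conductorMr.
Qed.

Definition column_rmul (a : subring A) (v : column) : column :=
  Sub (map_mx (fun x => x * val a) (val v)) (column_rmulP v a).

Fact column_rmul_linear a : linear (column_rmul a).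
Proof.
move=> M u v; apply: val_inj; apply/matrixP=> i j.
by rewrite /= !mxE mulrDl mulr_suml; congr (_ + _);
   apply: eq_bigr => k _; rewrite !mxE mulrA.
Qed.

HB.instance Definition _ a := GRing.isLinear.Build envelope column column *:%R
  (column_rmul a) (column_rmul_linear a).

(* The functor F = Hom(P, -), with (a f)(p) = f(p a). *)
Section HomColumn.
Variable M : lmodType envelope.

Definition hom_column : Type := {linear column -> M}.

Lemma hom_column_ext (f g : hom_column) : f =1 g -> f = g.
Proof.
move=> fg; have E : (f : column -> M) = g := funext fg.
case: f g E {fg} => [f cf] [g cg] /= E; subst g.
by move: cf cg => [[f0] [f1]] [[g0] [g1]];
   rewrite (Prop_irrelevance f0 g0) (Prop_irrelevance f1 g1).
Qed.

HB.instance Definition _ := gen_eqMixin hom_column.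
HB.instance Definition _ := gen_choiceMixin hom_column.

Definition hom_zero : hom_column := \0 : {linear column -> M}.
Definition hom_add (f g : hom_column) : hom_column :=
  f \+ g : {linear column -> M}.
Definition hom_opp (f : hom_column) : hom_column := \- f : {linear column -> M}.
Definition hom_scale (a : subring A) (f : hom_column) : hom_column :=
  f \o column_rmul a : {linear column -> M}.

Fact hom_addA : associative hom_add.
Proof. by move=> f g h; apply: hom_column_ext => p; exact: addrA. Qed.
Fact hom_addC : commutative hom_add.
Proof. by move=> f g; apply: hom_column_ext => p; exact: addrC. Qed.
Fact hom_add0 : left_id hom_zero hom_add.
Proof. by move=> f; apply: hom_column_ext => p; exact: add0r. Qed.
Fact hom_addN : left_inverse hom_zero hom_opp hom_add.
Proof. by move=> f; apply: hom_column_ext => p; exact: addNr. Qed.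

HB.instance Definition _ :=
  GRing.isZmodule.Build hom_column hom_addA hom_addC hom_add0 hom_addN.

Fact hom_scaleA a b f : hom_scale a (hom_scale b f) = hom_scale (a * b) f.
Proof.
apply: hom_column_ext => p; congr (f _); apply: val_inj.
by apply/matrixP=> i j; rewrite !mxE mulrA.
Qed.
Fact hom_scale1 : left_id 1 hom_scale.
Proof.
move=> f; apply: hom_column_ext => p; congr (f _); apply: val_inj.
by apply/matrixP=> i j; rewrite !mxE mulr1.
Qed.
Fact hom_scaleDr : right_distributive hom_scale +%R.
Proof. by move=> a f g; apply: hom_column_ext. Qed.
Fact hom_scaleDl f : {morph hom_scale^~ f : a b / a + b}.
Proof.
move=> a b; apply: hom_column_ext => p.
have -> : (hom_scale a f + hom_scale b f) p =
          f (column_rmul a p) + f (column_rmul b p) by [].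
rewrite -raddfD; congr (f _); apply: val_inj.
by apply/matrixP=> i j; rewrite !mxE mulrDr.
Qed.

HB.instance Definition _ := GRing.Zmodule_isLmodule.Build (subring A) hom_column
  hom_scaleA hom_scale1 hom_scaleDr hom_scaleDl.

End HomColumn.

Definition hom_column_map (M N : lmodType envelope) (g : {linear M -> N})
  (f : hom_column M) : hom_column N := g \o f : {linear column -> N}.

Fact hom_column_map_linear M N g : linear (@hom_column_map M N g).
Proof. by move=> a f f'; apply: hom_column_ext => p; exact: linearD. Qed.

HB.instance Definition _ M N g := GRing.isLinear.Build (subring A)
  (hom_column M) (hom_column N) *:%R _ (@hom_column_map_linear M N g).

End Envelope.

Section Complexes.
Variable S : pzRingType.

Record complex : Type := Complex {
  cx_ob :> int -> lmodType S;
  cx_d : forall i, {linear cx_ob i -> cx_ob (i + 1)};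
  cx_dd : forall i x, cx_d (i + 1) (cx_d i x) = 0 }.

Record chain_map (X Y : complex) : Type := ChainMap {
  cm_fun :> forall i, {linear X i -> Y i};
  cm_comm : forall i x, cm_fun (i + 1) (cx_d X i x) = cx_d Y i (cm_fun i x) }.

Program Definition cm_id (X : complex) : chain_map X X :=
  @ChainMap X X (fun i => idfun) _.

Program Definition cm_comp (X Y Z : complex)
    (f : chain_map X Y) (g : chain_map Y Z) : chain_map X Z :=
  @ChainMap X Z (fun i => g i \o f i) _.
Next Obligation. by rewrite /= !cm_comm. Qed.

(* Bijectivity of H^(i+1)(f) for all i; the index is shifted so that the
   coboundaries are the values of cx_d i. *)
Definition quasi_iso (X Y : complex) (f : chain_map X Y) : Prop :=
  forall i : int,
    (forall x : X (i + 1), cx_d X (i + 1) x = 0 ->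
      (exists y, f (i + 1) x = cx_d Y i y) -> exists x', x = cx_d X i x') /\
    (forall y : Y (i + 1), cx_d Y (i + 1) y = 0 ->
      exists x, cx_d X (i + 1) x = 0 /\ exists y', y = f (i + 1) x + cx_d Y i y').

Program Definition shift (X : complex) : complex :=
  @Complex (fun i => X (i + 1)) (fun i => \- cx_d X (i + 1)) _.
Next Obligation. by rewrite /= linearN cx_dd !oppr0. Qed.

Program Definition cm_shift (X Y : complex) (f : chain_map X Y) :
    chain_map (shift X) (shift Y) :=
  @ChainMap (shift X) (shift Y) (fun i => f (i + 1)) _.
Next Obligation. by rewrite /= linearN cm_comm. Qed.

Lemma quasi_iso_shift (X Y : complex) (f : chain_map X Y) :
  quasi_iso f -> quasi_iso (cm_shift f).
Proof.
move=> qf i; have [fi fs] := qf (i + 1); split=> /=.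
- move=> x /eqP; rewrite oppr_eq0 => /eqP dx [y fx].
  have [|x' ->] := fi x dx; first by exists (- y); rewrite linearN.
  by exists (- x'); rewrite linearN opprK.
- move=> y /eqP; rewrite oppr_eq0 => /eqP /fs [x [dx [y' ->]]].
  exists x; split; first by rewrite dx oppr0.
  by exists (- y'); rewrite linearN opprK.
Qed.

Program Definition zero_complex : complex :=
  @Complex (fun i => 'rV[S]_0) (fun i => idfun) _.
Next Obligation. by rewrite [LHS]thinmx0. Qed.

Definition dsum_fun (U U' V V' : lmodType S)
    (f : {linear U -> V}) (g : {linear U' -> V'}) (u : U * U') : V * V' :=
  (f u.1, g u.2).

Fact dsum_fun_linear U U' V V' f g : linear (@dsum_fun U U' V V' f g).
Proof. by move=> a u v; rewrite /dsum_fun /= !linearP. Qed.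

HB.instance Definition _ U U' V V' f g :=
  GRing.isLinear.Build S _ _ *:%R _ (@dsum_fun_linear U U' V V' f g).

Program Definition dsum (X Y : complex) : complex :=
  @Complex (fun i => prod (X i) (Y i)) (fun i => dsum_fun (cx_d X i) (cx_d Y i)) _.
Next Obligation. by rewrite /dsum_fun /= !cx_dd. Qed.

Section Cone.
Variables (X Y : complex) (f : chain_map X Y).

Definition cone_d (i : int) (u : X (i + 1) * Y i) : X (i + 1 + 1) * Y (i + 1) :=
  (- cx_d X (i + 1) u.1, f (i + 1) u.1 + cx_d Y i u.2).

Fact cone_d_linear i : linear (@cone_d i).
Proof.
move=> a u v; apply: injective_projections; rewrite /=.
  by rewrite linearP opprD scalerN.
by rewrite (linearP (f (i + 1))) (linearP (cx_d Y i)) scalerDr addrACA.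
Qed.

HB.instance Definition _ i := GRing.isLinear.Build S _ _ *:%R _ (@cone_d_linear i).

Program Definition cone : complex :=
  @Complex (fun i => prod (X (i + 1)) (Y i)) (fun i => @cone_d i) _.
Next Obligation.
by rewrite /cone_d /= linearN cx_dd !oppr0 linearN linearD cx_dd addr0 cm_comm addNr.
Qed.

Definition cone_in_fun (i : int) (y : Y i) : X (i + 1) * Y i := (0, y).

Fact cone_in_linear i : linear (@cone_in_fun i).
Proof.
by move=> a u v; apply: injective_projections; rewrite //= scaler0 addr0.
Qed.

HB.instance Definition _ i := GRing.isLinear.Build S _ _ *:%R _ (@cone_in_linear i).

Program Definition cone_in : chain_map Y cone :=
  @ChainMap Y cone (fun i => @cone_in_fun i) _.
Next Obligation. by rewrite /cone_in_fun /cone_d /= !linear0 ?oppr0 add0r. Qed.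

Program Definition cone_out : chain_map cone (shift X) :=
  @ChainMap cone (shift X) (fun i => fst) _.

End Cone.

(* The derived category, as the Gabriel-Zisman localization of the
   category of complexes at the quasi-isomorphisms: a morphism is a word
   in chain maps and formal inverses of quasi-isomorphisms, composed in
   diagrammatic order, and two words are equal in D(S) when related by
   the congruence der_eq. *)

Inductive der_hom : complex -> complex -> Type :=
| der_map X Y of chain_map X Y : der_hom X Y
| der_inv X Y (s : chain_map X Y) of quasi_iso s : der_hom Y X
| der_comp X Y Z of der_hom X Y & der_hom Y Z : der_hom X Z.

Definition der_id (X : complex) : der_hom X X := der_map (cm_id X).

Inductive der_eq : forall X Y, der_hom X Y -> der_hom X Y -> Prop :=
| der_eq_refl X Y (f : der_hom X Y) : der_eq f f
| der_eq_sym X Y (f g : der_hom X Y) : der_eq f g -> der_eq g f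
| der_eq_trans X Y (f g h : der_hom X Y) :
    der_eq f g -> der_eq g h -> der_eq f h
| der_eq_comp X Y Z (f f' : der_hom X Y) (g g' : der_hom Y Z) :
    der_eq f f' -> der_eq g g' -> der_eq (der_comp f g) (der_comp f' g')
| der_eq_assoc X Y Z T (f : der_hom X Y) (g : der_hom Y Z) (h : der_hom Z T) :
    der_eq (der_comp f (der_comp g h)) (der_comp (der_comp f g) h)
| der_eq_idl X Y (f : der_hom X Y) : der_eq (der_comp (der_id X) f) f
| der_eq_idr X Y (f : der_hom X Y) : der_eq (der_comp f (der_id Y)) f
| der_eq_ext X Y (f g : chain_map X Y) :
    (forall i, f i =1 g i) -> der_eq (der_map f) (der_map g)
| der_eq_map X Y Z (f : chain_map X Y) (g : chain_map Y Z) :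
    der_eq (der_comp (der_map f) (der_map g)) (der_map (cm_comp f g))
| der_eq_invl X Y (s : chain_map X Y) (qs : quasi_iso s) :
    der_eq (der_comp (der_inv qs) (der_map s)) (der_id Y)
| der_eq_invr X Y (s : chain_map X Y) (qs : quasi_iso s) :
    der_eq (der_comp (der_map s) (der_inv qs)) (der_id X).

Definition is_der_iso (X Y : complex) (f : der_hom X Y) : Prop :=
  exists g : der_hom Y X,
    der_eq (der_comp f g) (der_id X) /\ der_eq (der_comp g f) (der_id Y).

Definition der_iso (X Y : complex) : Prop :=
  exists f : der_hom X Y, is_der_iso f.

Fixpoint der_shift X Y (f : der_hom X Y) : der_hom (shift X) (shift Y) :=
  match f with
  | der_map _ _ f => der_map (cm_shift f)
  | der_inv _ _ _ qs => der_inv (quasi_iso_shift qs)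
  | der_comp _ _ _ f g => der_comp (der_shift f) (der_shift g)
  end.

(* Triangles isomorphic in D(S) to X' -> Y' -> cone f -> X'[1]. *)
Definition exact_triangle (X Y Z : complex) (u : der_hom X Y) (v : der_hom Y Z)
    (w : der_hom Z (shift X)) : Prop :=
  exists (X' Y' : complex) (f : chain_map X' Y')
         (a : der_hom X' X) (b : der_hom Y' Y) (c : der_hom (cone f) Z),
    [/\ is_der_iso a, is_der_iso b & is_der_iso c] /\
    [/\ der_eq (der_comp (der_map f) b) (der_comp a u),
        der_eq (der_comp (der_map (cone_in f)) c) (der_comp b v) &
        der_eq (der_comp (der_map (cone_out f)) (der_shift a)) (der_comp c w)].

(* T is the class of objects of a full triangulated subcategory of D(S). *)

Section Generation.
Variable T : complex -> Prop.
Implicit Types M N : complex -> Prop.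

(* <M>; direct sums are finite, the empty one included. *)
Inductive add_closure M : complex -> Prop :=
| add_base X : T X -> M X -> add_closure M X
| add_zero X : T X -> der_iso X zero_complex -> add_closure M X
| add_dsum X Y Z : T Z -> add_closure M X -> add_closure M Y ->
    der_iso Z (dsum X Y) -> add_closure M Z
| add_summand X X' Z : T X -> T X' -> add_closure M Z ->
    der_iso Z (dsum X X') -> add_closure M X
| add_shift X Y : T Y -> add_closure M X -> der_iso Y (shift X) ->
    add_closure M Y
| add_unshift X Y : T Y -> add_closure M X -> der_iso (shift Y) X ->
    add_closure M Y.

(* The class of all X in a triangle Y -> Z -> X -> Y[1], Y in M, Z in N. *)
Definition dagger M N (X : complex) : Prop :=
  T X /\ exists (Y Z : complex) (u : der_hom Y Z) (v : der_hom Z X)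
                (w : der_hom X (shift Y)),
    [/\ M Y, N Z & exact_triangle u v w].

(* gen_succ M k is <M>_(k+1). *)
Fixpoint gen_succ M (k : nat) : complex -> Prop :=
  if k is k'.+1 then add_closure (dagger (add_closure M) (gen_succ M k'))
  else add_closure M.

(* M is a class of objects of T with <M>_(k+1) = T. *)
Definition generates M (k : nat) : Prop :=
  (forall X, M X -> T X) /\ (forall X, gen_succ M k X <-> T X).

Definition finitely_generated_at (k : nat) : Prop :=
  exists (n : nat) (m : 'I_n -> complex),
    generates (fun X => exists i, X = m i) k.

Definition dimension_is (k : nat) : Prop :=
  finitely_generated_at k /\
  forall j : nat, finitely_generated_at j -> (k <= j)%N.

End Generation.

Definition fin_gen (M : lmodType S) : Prop :=
  exists (n : nat) (v : 'I_n -> M),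
    forall x, exists c : 'I_n -> S, x = \sum_i c i *: v i.

Definition projective (P : lmodType S) : Prop :=
  forall (M N : lmodType S) (g : {linear M -> N}) (f : {linear P -> N}),
    (forall y, exists x, g x = y) ->
    exists h : {linear P -> M}, forall x, g (h x) = f x.

Definition bounded_cohomology (X : complex) : Prop :=
  exists m n : int, forall i, (i < m)%R \/ (n < i)%R ->
    forall x : X (i + 1), cx_d X (i + 1) x = 0 -> exists y, x = cx_d X i y.

(* D_f^b(S): bounded cohomology, and isomorphic in D(S) to a complex of finitely
   generated projectives, taken bounded on the right.  Over a left noetherian
   ring the right bound is automatic and these are the complexes with bounded,
   finitely generated cohomology; over other rings it makes the modules in
   D_f^b(S) those with a resolution by finitely generated projectives. *)
Definition Dfb (X : complex) : Prop :=
  bounded_cohomology X /\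
  exists P : complex,
    [/\ forall i, fin_gen (P i) /\ projective (P i),
        exists n : int, forall i, (n < i)%R -> forall x : P i, x = 0 &
        der_iso P X].

End Complexes.

(* der.dim S = k; S has no derived dimension when no such k exists. *)
Definition der_dim_is (S : pzRingType) (k : nat) : Prop :=
  dimension_is (@Dfb S) k.

(* DF : F applied componentwise. *)
Program Definition DF (H : pzRingType) (A : subringClosed H)
    (X : complex (envelope A)) : complex (subring A) :=
  @Complex (subring A) (fun i => hom_column (X i))
    (fun i => hom_column_map (cx_d X i)) _.
Next Obligation. by apply: hom_column_ext => p; exact: cx_dd. Qed.

Definition DF_image (H : pzRingType) (A : subringClosed H)
    (M : complex (envelope A) -> Prop) (Y : complex (subring A)) : Prop :=
  exists X, M X /\ Y = DF X.

(* Main.v *)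
Require Import Defs.
From HB Require Import structures.
From mathcomp Require Import all_boot all_order all_algebra.
From Corelib Require Import Setoid Morphisms.
From mathcomp Require Import ssrAC zify.
From mathcomp Require Import boolp classical_sets functions.

Set Implicit Arguments.
Unset Strict Implicit.
Unset Printing Implicit Defensive.

Import GRing.Theory.
Local Open Scope ring_scope.

(** The functor [F] is multiplication by the first matrix unit of the envelope. It
    is exact and so induces a functor of derived categories which preserves
    isomorphisms, sums, shifts and triangles; it therefore maps the [k]-th stage
    of the generation by [M] into the [k]-th stage of the generation by [DF M]
    ([gen_succ_DF]). Both claims follow as soon as every object [Y] of [Dfb] over
    [A] is isomorphic to [DF X] for some [X] in [Dfb] over the envelope
    ([DF_essentially_surjective]).

    Let [P] be a complex of finitely generated projective [A]-modules, bounded on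
    the right, which represents [Y]. Tensoring [P] with the first column of the
    envelope gives a complex of projectives mapped to [P] by [F], but its
    cohomology need not be bounded. So it is only kept in degrees above some [j]
    such that [P] is exact in degrees at most [j + 1]. Let [N] be the module of
    coboundaries in degree [j + 1]. As [A] is semiperfect, [N] has a projective
    cover [Q -> N]: its kernel [K] lies in [rad Q], and since [rad A] is also the
    radical of [H], this kernel is an [H]-module ([minimal_kernel_submodule]).
    Resolve [K] by free [H]-modules. An [H]-module [R] gives the module [(R; R)]
    over the envelope, exactly and preserving projectivity, so the resolution,
    followed by the columns [(Q; C Q)] in degree [j] and [(P^i; C P^i)] above,
    is a complex [X] of projectives over the envelope. It is exact in low degrees,
    and [F X] is quasi-isomorphic to [P] ([Dfb_lift], [der_iso_lift]).

    What has to be shown is that the free modules resolving [K] can be taken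
    finitely generated, although [H] need not be finitely generated over [A] and
    no chain condition is assumed. Over [A] the module [K] has such a resolution,
    by comparison with [P]. To pass from [A] to [H], cover an [H]-module [M]
    minimally over [A], by [Q]. The kernel [L] of the induced [H]-linear cover
    [H Q -> M] meets [rad (H Q)] in the kernel of [Q -> M], and its image in the
    semisimple module [H Q / rad] is a direct summand; this makes [L] a retract of
    the sum of the [A]-syzygy of [M] and a free [H]-module
    ([projection_mod_radical], [tame_syzygy]). Schanuel's lemma, in a form for
    such stable retracts ([stable_retract_ker]), carries the argument from one
    syzygy to the next.

    All modules used for [X] are realized inside the module of sequences in [H]
    or inside pairs of such sequences, as predicates. The three shapes of terms
    of [X] are then distinguished by a condition on the degree, and no transport
    along equalities of degrees is needed. *)

(** * Left ideals, the Jacobson radical and Nakayama's lemma *)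

Section Radical.
Variable S : pzRingType.
Implicit Types L : S -> Prop.

Lemma left_ideal_jacobson : left_ideal (@jacobson S).
Proof.
split=> [L [[L0 _ _] _ _] //|x y Jx Jy L mL|a x Jx L mL];
  have [[_ LD LM] _ _] := mL.
- by apply: LD; [exact: Jx | exact: Jy].
- by apply: LM; exact: Jx.
Qed.

Lemma jacobson0 : jacobson (0 : S).
Proof. by have [] := left_ideal_jacobson. Qed.

Lemma jacobsonD (x y : S) : jacobson x -> jacobson y -> jacobson (x + y).
Proof. by have [_ + _] := left_ideal_jacobson; apply. Qed.

Lemma jacobsonM (a x : S) : jacobson x -> jacobson (a * x).
Proof. by have [_ _ +] := left_ideal_jacobson; apply. Qed.

Lemma jacobsonN (x : S) : jacobson x -> jacobson (- x).
Proof. by rewrite -mulN1r; exact: jacobsonM. Qed.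

Lemma jacobsonB (x y : S) : jacobson x -> jacobson y -> jacobson (x - y).
Proof. by move=> Jx Jy; apply: jacobsonD => //; exact: jacobsonN. Qed.

Lemma jacobson_sum (I : Type) (r : seq I) (P : pred I) (F : I -> S) :
  (forall i, P i -> jacobson (F i)) -> jacobson (\sum_(i <- r | P i) F i).
Proof.
by move=> JF; apply: (big_ind (@jacobson S)) => //; [exact: jacobson0|exact: jacobsonD].
Qed.

(** By Zorn's lemma. The chains consist of sets whose union with [L0] is a proper
    left ideal, so that the empty chain is covered too. *)
Lemma maximal_left_ideal_above L0 : left_ideal L0 -> ~ L0 1 ->
  exists L, maximal_left_ideal L /\ forall x, L0 x -> L x.
Proof.
move=> [L00 L0D L0M] L01.
pose good (B : set S) :=
  left_ideal (fun x => L0 x \/ B x) /\ ~ (L0 1 \/ B 1).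
have [F Fgood Ftot|B [[Bl B1] Bmax]] := @Zorn_bigcup S good.
  have common x y : L0 x \/ (exists2 X, F X & X x) ->
      L0 y \/ (exists2 X, F X & X y) -> (L0 x /\ L0 y) \/
      exists2 X, F X & (L0 x \/ X x) /\ (L0 y \/ X y).
    move=> [Lx|[X FX Xx]] [Ly|[Y FY Yy]]; first by left.
    - by right; exists Y => //; split; [left|right].
    - by right; exists X => //; split; [right|left].
    - right; have [XY|YX] := Ftot X Y FX FY.
        by exists Y => //; split; right => //; exact: XY.
      by exists X => //; split; right => //; exact: YX.
  split; last by case=> // -[X FX X1]; case: (Fgood X FX) => _; apply; right.
  split=> [|x y Hx Hy|a x Hx]; first by left.
    have [[Lx Ly]|[X FX [Xx Xy]]] := common x y Hx Hy; first by left; exact: L0D.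
    have [[_ XD _] _] := Fgood X FX.
    by have [?|?] := XD x y Xx Xy; [left | right; exists X].
  have [[Lx _]|[X FX [Xx _]]] := common x x Hx Hx; first by left; exact: L0M.
  have [[_ _ XM] _] := Fgood X FX.
  by have [?|?] := XM a x Xx; [left | right; exists X].
exists (fun x => L0 x \/ B x); split; last by left.
split=> // L' L'l L'1 BL x L'x.
apply: contrapT => nBx; apply: (Bmax L').
  split; first by move=> y By; apply: BL; right.
  by move=> L'B; apply: nBx; right; exact: L'B.
rewrite /good; have -> : (fun x => L0 x \/ L' x) = L'.
  by apply/funext => y; apply/propext; split=> [[Ly|//]|]; [apply: BL; left|right].
by split=> // -[L01'|] //.
Qed.

Lemma left_inverse_1Bjacobson (r : S) : jacobson r -> exists u, u * (1 - r) = 1.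
Proof.
move=> Jr; apply: contrapT => nu.
have [||L [mL LL]] := @maximal_left_ideal_above (fun x => exists u, x = u * (1 - r)).
- split=> [|x y [u ->] [v ->]|a x [u ->]].
  + by exists 0; rewrite mul0r.
  + by exists (u + v); rewrite mulrDl.
  + by exists (a * u); rewrite mulrA.
- by case=> u u1; apply: nu; exists u.
have Lr := Jr L mL; have [[_ LD _] L1 _] := mL; apply: L1.
rewrite -[1](subrK r); apply: LD => //; apply: LL; exists 1; by rewrite mul1r.
Qed.

Lemma nakayama (V : lmodType S) (N : V -> Prop) (n : nat) (x : nat -> V) :
    N 0 -> (forall a u v, N u -> N v -> N (a *: u + v)) ->
    (forall i, (i < n)%N -> exists r : nat -> S,
      (forall l, jacobson (r l)) /\ N (x i - \sum_(l < n) r l *: x l)) ->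
  forall i, (i < n)%N -> N (x i).
Proof.
move=> N0 NL; elim: n => [//|n IHn] hx.
have ND u v : N u -> N v -> N (u + v).
  by move=> Nu Nv; rewrite -[u]scale1r; exact: NL.
(* Solve the last congruence for x_n and eliminate it from the others. *)
have [s [Js Nn]] : exists s : nat -> S, (forall l, jacobson (s l)) /\
    N (x n - \sum_(l < n) s l *: x l).
  have [r [Jr Nr]] := hx n (ltnSn n).
  have [u ur] := left_inverse_1Bjacobson (Jr n).
  exists (fun l => u * r l); split=> [l|]; first exact: jacobsonM.
  have := NL u _ _ Nr N0; congr (N _); rewrite addr0 big_ord_recr /=.
  rewrite [_ + r n *: _]addrC opprD addrA.
  have -> : x n - r n *: x n = (1 - r n) *: x n by rewrite scalerBl scale1r.
  rewrite scalerBr scalerA ur scale1r scaler_sumr.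
  by congr (_ - _); apply: eq_bigr => l _; rewrite scalerA.
have Nlt : forall i, (i < n)%N -> N (x i).
  apply: IHn => i lt_in; have [r [Jr Nr]] := hx i (leqW lt_in).
  exists (fun l => r l + r n * s l); split=> [l|].
    by apply: jacobsonD => //; exact: jacobsonM.
  have := NL (r n) _ _ Nn Nr; congr (N _).
  rewrite big_ord_recr /= opprD scalerBr.
  under [in RHS]eq_bigr do rewrite scalerDl -scalerA.
  rewrite big_split /= -scaler_sumr opprD.
  by rewrite [LHS](AC (2*(1*2)) ((1*5)*(3*(4*2)))) /= subrr add0r.
move=> i; rewrite ltnS leq_eqVlt => /orP[/eqP->|]; last exact: Nlt.
suff Ns : N (\sum_(l < n) s l *: x l) by have := ND _ _ Nn Ns; rewrite subrK.
apply: (big_ind N) => [//|u v|l _]; first exact: ND.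
by rewrite -[_ *: _]addr0; apply: NL => //; exact: Nlt.
Qed.

End Radical.

(** * Submodules, maps defined on them, and stable retracts *)

Section Submodules.
Variable S : pzRingType.

Definition submodule (V : lmodType S) (K : V -> Prop) : Prop :=
  K 0 /\ forall a u v, K u -> K v -> K (a *: u + v).

(** A map is given on an ambient module and is only required to be linear on
    the submodule where it matters, which makes gluing and choosing maps free. *)
Definition lin_on (V W : lmodType S) (K : V -> Prop) (f : V -> W) : Prop :=
  forall a u v, K u -> K v -> f (a *: u + v) = a *: f u + f v.

Section Closure.
Variables (V : lmodType S) (K : V -> Prop).
Hypothesis hK : submodule K.

Lemma submodule0 : K 0. Proof. by case: hK. Qed.

Lemma submoduleD u v : K u -> K v -> K (u + v).
Proof. by move=> Ku Kv; rewrite -[u]scale1r; apply: hK.2. Qed.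

Lemma submoduleZ a u : K u -> K (a *: u).
Proof. by move=> Ku; rewrite -[_ *: _]addr0; apply: hK.2 => //; case: hK. Qed.

Lemma submoduleB u v : K u -> K v -> K (u - v).
Proof.
by move=> Ku Kv; apply: submoduleD => //; rewrite -scaleN1r; exact: submoduleZ.
Qed.

Lemma submodule_sum (I : Type) (r : seq I) (P : pred I) (F : I -> V) :
  (forall i, P i -> K (F i)) -> K (\sum_(i <- r | P i) F i).
Proof.
move=> KF; apply: (big_ind K) => //; [exact: submodule0 | exact: submoduleD].
Qed.

Variables (W : lmodType S) (f : V -> W).
Hypothesis fK : lin_on K f.

Lemma lin_on0 : f 0 = 0.
Proof.
apply: (addrI (f 0)); rewrite addr0.
by have := fK 1 submodule0 submodule0; rewrite !scale1r addr0.
Qed.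

Lemma lin_onD u v : K u -> K v -> f (u + v) = f u + f v.
Proof. by move=> Ku Kv; rewrite -[u in LHS]scale1r fK // scale1r. Qed.

Lemma lin_onZ a u : K u -> f (a *: u) = a *: f u.
Proof.
move=> Ku; rewrite -[_ *: _ in LHS]addr0 fK //; last exact: submodule0.
by rewrite lin_on0 addr0.
Qed.

Lemma lin_onB u v : K u -> K v -> f (u - v) = f u - f v.
Proof.
move=> Ku Kv; rewrite -scaleN1r lin_onD ?lin_onZ ?scaleN1r //.
by rewrite -scaleN1r; apply: submoduleZ.
Qed.

Lemma lin_on_sum (I : Type) (r : seq I) (P : pred I) (F : I -> V) :
    (forall i, P i -> K (F i)) ->
  f (\sum_(i <- r | P i) F i) = \sum_(i <- r | P i) f (F i).
Proof.
move=> KF; elim: r => [|i r IHr]; first by rewrite !big_nil lin_on0.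
rewrite !big_cons; case: ifP => // Pi.
by rewrite lin_onD ?IHr //; [exact: KF | exact: submodule_sum].
Qed.

Lemma submodule_ker : submodule (fun u => K u /\ f u = 0).
Proof.
split=> [|a u v [Ku fu] [Kv fv]]; first by rewrite lin_on0; split=> //; case: hK.
by rewrite fK // fu fv scaler0 addr0; split=> //; apply: hK.2.
Qed.

End Closure.

Lemma lin_on_linear (V W : lmodType S) (K : V -> Prop) (f : {linear V -> W}) :
  lin_on K f.
Proof. by move=> a u v _ _; rewrite linearP. Qed.

Lemma lin_on_comp (V W X : lmodType S) (K : V -> Prop) (L : W -> Prop)
    (f : V -> W) (g : W -> X) :
  lin_on K f -> (forall u, K u -> L (f u)) -> lin_on L g -> lin_on K (g \o f).
Proof. by move=> fK KL gL a u v Ku Kv /=; rewrite fK // gL //; exact: KL. Qed.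

Lemma lin_on_add (V W : lmodType S) (K : V -> Prop) (f g : V -> W) :
  lin_on K f -> lin_on K g -> lin_on K (fun u => f u + g u).
Proof. by move=> fK gK a u v Ku Kv; rewrite fK // gK // scalerDr addrACA. Qed.

Lemma lin_on_opp (V W : lmodType S) (K : V -> Prop) (f : V -> W) :
  lin_on K f -> lin_on K (fun u => - f u).
Proof. by move=> fK a u v Ku Kv; rewrite fK // scalerN opprD. Qed.

Lemma lin_on_sumZ (V W : lmodType S) (K : V -> Prop) (I : finType)
    (xi : I -> V -> S) (y : I -> W) :
  (forall i, @lin_on V S^o K (xi i)) -> lin_on K (fun u => \sum_i xi i u *: y i).
Proof.
move=> xiK a u v Ku Kv; rewrite scaler_sumr -big_split; apply: eq_bigr => i _ /=.
by rewrite xiK // scalerDl scalerA.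
Qed.

(** The working form of being finitely generated projective: unlike the lifting
    property it does not quantify over all modules. *)
Definition dual_basis (V : lmodType S) (K : V -> Prop) (n : nat) (v : nat -> V)
    (phi : nat -> V -> S) : Prop :=
  [/\ forall a, (a < n)%N -> K (v a), forall a, @lin_on V S^o K (phi a) &
      forall u, K u -> u = \sum_(a < n) phi a u *: v a].

Definition fgp_on (V : lmodType S) (K : V -> Prop) : Prop :=
  exists n v phi, @dual_basis V K n v phi.

Lemma fgp_lift (V V' W : lmodType S) (F : V -> Prop) (G : V' -> Prop)
    (K : W -> Prop) (f : V -> W) (g : V' -> W) :
    submodule F -> submodule G -> fgp_on F -> lin_on F f -> lin_on G g ->
    (forall u, F u -> K (f u)) -> (forall w, K w -> exists2 u, G u & g u = w) ->
  exists h : V -> V', [/\ lin_on F h, forall u, F u -> G (h u) &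
    forall u, F u -> g (h u) = f u].
Proof.
move=> hF hG [n [v [phi [Fv phiF dbF]]]] fF gG fK gK.
have /choice[w wP] : forall a : 'I_n, exists w, G w /\ g w = f (v a).
  by move=> a; have [w] := gK _ (fK _ (Fv a (ltn_ord a))); exists w.
exists (fun u => \sum_(a < n) phi a u *: w a); split.
- by apply: lin_on_sumZ => a; exact: phiF.
- move=> u Fu; apply: submodule_sum => // a _.
  by apply: submoduleZ => //; case: (wP a).
- move=> u Fu; rewrite (lin_on_sum hG gG); last first.
    by move=> a _; apply: submoduleZ => //; case: (wP a).
  rewrite [u in RHS]dbF // (lin_on_sum hF fF); last first.
    by move=> a _; apply: submoduleZ => //; exact: Fv.
  apply: eq_bigr => a _; have [Gw gw] := wP a.
  by rewrite (lin_onZ hG gG) // gw (lin_onZ hF fF) //; exact: Fv.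
Qed.

(** [K] is a stable retract of [B] when the identity of [K] is the sum of a map
    through [B] and of a map through a finitely generated free module, i.e. when
    [K] is a direct summand of the sum of [B] and a finite free module. *)
Definition stable_retract (V W : lmodType S) (K : V -> Prop) (B : W -> Prop) :=
  exists (s : V -> W) (p : W -> V) (I : finType) (xi : I -> V -> S) (y : I -> V),
  [/\ [/\ lin_on K s & forall u, K u -> B (s u)],
      [/\ lin_on B p & forall w, B w -> K (p w)],
      (forall i, @lin_on V S^o K (xi i)) /\ forall i, K (y i) &
      forall u, K u -> u = p (s u) + \sum_i xi i u *: y i].

Lemma stable_retract_refl (V : lmodType S) (K : V -> Prop) : stable_retract K K.
Proof.
exists id, id, void, (@of_void _), (@of_void _).
by split=> [|||u _]; [split|split|split; case|rewrite big_pred0 ?addr0 //; case].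
Qed.

Lemma stable_retract_trans (V W X : lmodType S)
    (K : V -> Prop) (L : W -> Prop) (M : X -> Prop) :
    submodule K -> submodule L ->
  stable_retract K L -> stable_retract L M -> stable_retract K M.
Proof.
move=> hK hL [s [p [I [xi [y [[sK KL] [pL LK] [xiK Ky] E]]]]]].
move=> [t [q [J [zeta [z [[tL LM] [qM ML] [zL Lz] E']]]]]].
exists (t \o s), (p \o q), (I + J)%type.
exists (fun i => match i with inl i => xi i | inr j => zeta j \o s end).
exists (fun i => match i with inl i => y i | inr j => p (z j) end).
split=> [|||u Ku].
- by split=> [|u Ku /=]; [exact: lin_on_comp tL | apply/LM/KL].
- by split=> [|u Ku /=]; [exact: lin_on_comp pL | apply/LK/ML].
- split; case=> i //; last exact/LK.
  by apply: (lin_on_comp sK KL); exact: zL.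
have Ls := KL u Ku; rewrite [LHS]E // {1}(E' (s u)) // big_sumType /=.
have Lzz : L (\sum_i zeta i (s u) *: z i).
  by apply: submodule_sum => // i _; exact: submoduleZ.
rewrite (lin_onD pL) ?(lin_on_sum hL pL) //; try by apply/ML/LM.
  rewrite -addrA [X in _ + X]addrC; congr (_ + (_ + _)).
  by apply: eq_bigr => i _; rewrite (lin_onZ hL pL).
by move=> i _; exact: submoduleZ.
Qed.

(** Schanuel's lemma: comparing [F -> K] and [G -> B] through lifts of the
    structure maps, the defect of the composite [F -> G -> F] from the identity
    takes values in the kernel, and factors through the dual basis of [F]. *)
Lemma stable_retract_ker (V V' W W' : lmodType S) (F : V -> Prop)
    (G : V' -> Prop) (K : W -> Prop) (B : W' -> Prop) (f : V -> W) (g : V' -> W') :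
    submodule F -> submodule G -> submodule K -> submodule B ->
    fgp_on F -> fgp_on G -> lin_on F f -> lin_on G g ->
    (forall u, F u -> K (f u)) -> (forall w, K w -> exists2 u, F u & f u = w) ->
    (forall u, G u -> B (g u)) -> (forall w, B w -> exists2 u, G u & g u = w) ->
    stable_retract K B ->
  stable_retract (fun u => F u /\ f u = 0) (fun u => G u /\ g u = 0).
Proof.
move=> hF hG hK hB pF pG fF gG FK fonto GB gonto.
move=> [s [p [I [xi [y [[sK KB] [pB BK] [xiK Ky] E]]]]]].
have [alpha [aF aG ga]] : exists h : V -> V', [/\ lin_on F h,
    forall u, F u -> G (h u) & forall u, F u -> g (h u) = (s \o f) u].
  apply: (@fgp_lift _ _ _ _ _ B) => //; first exact: lin_on_comp sK.
  by move=> u Fu /=; apply/KB/FK.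
have [beta [bG bF fb]] : exists h : V' -> V, [/\ lin_on G h,
    forall u, G u -> F (h u) & forall u, G u -> f (h u) = (p \o g) u].
  apply: (@fgp_lift _ _ _ _ _ K) => //; first exact: lin_on_comp pB.
  by move=> u Gu /=; apply/BK/GB.
have /choice[w wP] : forall i, exists w, F w /\ f w = y i.
  by move=> i; have [w] := fonto _ (Ky i); exists w.
have [n [v [phi [Fv phiF dbF]]]] := pF.
pose theta u := u - beta (alpha u) - \sum_i xi i (f u) *: w i.
have Fba u : F u -> F (beta (alpha u)) by move=> Fu; apply/bF/aG.
have Fw u : F (\sum_i xi i (f u) *: w i).
  by apply: submodule_sum => // i _; apply: submoduleZ => //; case: (wP i).
have thetaF : lin_on F theta.
  apply: lin_on_add; last first.
    by apply: lin_on_opp; apply: lin_on_sumZ => i; exact: lin_on_comp (xiK i).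
  apply: lin_on_add; first by move=> a u u' _ _.
  by apply: lin_on_opp; exact: (lin_on_comp aF aG bG).
have Ftheta u : F u -> F (theta u).
  by move=> Fu; do 2?apply: submoduleB => //; exact: Fba.
have ftheta u : F u -> f (theta u) = 0.
  move=> Fu; have Fbau := Fba u Fu; have Fub : F (u - beta (alpha u)).
    exact: submoduleB.
  rewrite /theta (lin_onB hF fF Fub (Fw u)) (lin_onB hF fF Fu Fbau).
  rewrite (lin_on_sum hF fF) => [|i _]; last first.
    by apply: submoduleZ => //; case: (wP i).
  rewrite (fb _ (aG u Fu)) /= (ga _ Fu) /= {1}(E (f u) (FK u Fu)).
  rewrite [X in X - _]addrC addKr -sumrB big1 // => i _.
  by have [Fwi fw] := wP i; rewrite (lin_onZ hF fF) // fw subrr.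
exists alpha, beta, 'I_n, (fun a : 'I_n => phi a), (fun a : 'I_n => theta (v a)).
split.
- split=> [a u u' [Fu _] [Fu' _]|u [Fu fu]]; first exact: aF.
  by split; [exact: aG | rewrite ga //= fu (lin_on0 hK sK)].
- split=> [a u u' [Gu _] [Gu' _]|u [Gu gu]]; first exact: bG.
  by split; [exact: bF | rewrite fb //= gu (lin_on0 hB pB)].
- split=> [a b u u' [Fu _] [Fu' _]|a]; first exact: phiF.
  by split; [apply: Ftheta | apply: ftheta]; exact: Fv.
move=> u [Fu fu].
have -> : \sum_(a < n) phi a u *: theta (v a) = theta u.
  rewrite [u in RHS]dbF // (lin_on_sum hF thetaF).
    by apply: eq_bigr => a _; rewrite (lin_onZ hF thetaF) //; exact: Fv.
  by move=> a _; apply: submoduleZ => //; exact: Fv.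
rewrite /theta fu big1 => [|i _]; first by rewrite subr0 addrC subrK.
by rewrite (lin_on0 hK (xiK i)) scale0r.
Qed.

(** * Finite generation and sums of left ideals generated by idempotents *)

Definition combination (V : lmodType S) (n : nat) (x : nat -> V)
  (u : nat -> S^o) : V := \sum_(a < n) (u a : S) *: x a.

Fact combination_linear V n x : linear (@combination V n x).
Proof.
move=> a u v; rewrite /combination scaler_sumr -big_split; apply: eq_bigr => i _.
by rewrite /= scalerDl scalerA.
Qed.

HB.instance Definition _ (V : lmodType S) n (x : nat -> V) :=
  GRing.isLinear.Build S (nat -> S^o) V *:%R
  (@combination V n x) (@combination_linear V n x).

Lemma combination_in (V : lmodType S) (K : V -> Prop) n (x : nat -> V) u :
  submodule K -> (forall a, (a < n)%N -> K (x a)) -> K (combination n x u).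
Proof.
move=> hK Kx; apply: submodule_sum => // a _; apply: submoduleZ => //.
exact: Kx.
Qed.

Definition generates_on (V : lmodType S) (K : V -> Prop) (n : nat) (x : nat -> V) :=
  (forall a, (a < n)%N -> K (x a)) /\
  forall u, K u -> exists c : nat -> S^o, u = combination n x c.

Definition fg_on (V : lmodType S) (K : V -> Prop) := exists n x, @generates_on V K n x.

Lemma fg_on_finType (V : lmodType S) (K : V -> Prop) (I : finType) (x : I -> V) :
    (forall i, K (x i)) ->
    (forall u, K u -> exists c : I -> S, u = \sum_i c i *: x i) ->
  fg_on K.
Proof.
move=> Kx gx; pose ext T (t0 : T) (t : I -> T) (a : nat) : T :=
    if insub a is Some i then t (enum_val (i : 'I_#|I|)) else t0.
have extE T (t0 : T) t (i : 'I_#|I|) : ext T t0 t i = t (enum_val i).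
  by rewrite /ext valK.
exists #|I|, (ext V 0 x); split=> [a lt_a|u Ku].
  by rewrite (extE _ _ _ (Ordinal lt_a)).
have [c ->] := gx u Ku; exists (ext _ 0 c).
rewrite (reindex (@enum_val I (mem predT))) /=; last first.
  by apply/onW_bij/enum_val_bij.
by apply: eq_bigr => i _; rewrite !extE.
Qed.

Lemma stable_retract_fg (V W : lmodType S) (K : V -> Prop) (B : W -> Prop) :
  submodule B -> stable_retract K B -> fg_on B -> fg_on K.
Proof.
move=> hB [s [p [I [xi [y [[sK KB] [pB BK] [xiK Ky] E]]]]]] [n [x [Bx gx]]].
apply: (@fg_on_finType _ _ ('I_n + I)%type
  (fun i => match i with inl a => p (x a) | inr i => y i end)).
  by case=> // a; apply/BK/Bx.
move=> u Ku; have [c sE] := gx _ (KB u Ku).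
exists (fun i : 'I_n + I =>
  match i with inl a => (c a : S) | inr i => xi i u end).
rewrite [LHS]E // sE big_sumType /= (lin_on_sum hB pB); last first.
  by move=> a _; apply: submoduleZ => //; exact: Bx.
by congr (_ + _); apply: eq_bigr => a _; rewrite (lin_onZ hB pB) //; exact: Bx.
Qed.

(** This is the direct sum of the projective modules [S e_a], [a < n], if the [e_a]
    are idempotents, and the free module of rank [n] if [e] is constantly [1]. *)
Definition corner (e : nat -> S) (n : nat) (u : nat -> S^o) : Prop :=
  (forall a, (n <= a)%N -> u a = 0) /\ forall a, (u a : S) * e a = u a.

Definition corner_basis (e : nat -> S) (a : nat) : nat -> S^o :=
  fun b => if b == a then e a else 0.

Lemma corner_submodule e n : submodule (corner e n).
Proof.
split=> [|a u v [u0 ue] [v0 ve]]; first by split=> // a; rewrite mul0r.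
split=> b; first by move=> le_nb; rewrite -[LHS]/(a * u b + v b) u0 ?v0 ?mulr0 ?addr0.
by rewrite -[_ b]/(a * u b + v b) mulrDl -mulrA ue ve.
Qed.

Lemma corner_sum e n u : corner e n u ->
  u = \sum_(a < n) (u a : S) *: corner_basis e a.
Proof.
move=> [u0 ue]; apply/funext => b; rewrite fct_sumE /=.
have [lt_bn|le_nb] := ltnP b n; last first.
  rewrite u0 // big1 // => a _; rewrite -[LHS]/(u a * corner_basis e a b).
  rewrite /corner_basis ifN ?mulr0 //; apply: contraTneq le_nb => ->.
  by rewrite -ltnNge.
rewrite (bigD1 (Ordinal lt_bn)) //= big1 ?addr0 => [|a ne_ab].
  by rewrite -[RHS]/(u b * corner_basis e b b) /corner_basis eqxx ue.
rewrite -[LHS]/(u a * corner_basis e a b) /corner_basis ifN ?mulr0 //.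
by apply: contraNneq ne_ab => E; apply/eqP/val_inj.
Qed.

Lemma corner_basis_in e n a : (forall a, e a * e a = e a) -> (a < n)%N ->
  corner e n (corner_basis e a).
Proof.
move=> ee lt_an; split=> b; rewrite /corner_basis.
  by case: eqP => // -> /(leq_trans lt_an); rewrite ltnn.
by case: eqP => [->|]; rewrite ?ee ?mul0r.
Qed.

Lemma corner_fgp e n : (forall a, e a * e a = e a) -> fgp_on (corner e n).
Proof.
move=> ee; exists n, (corner_basis e), (fun a u => u a); split=> //.
  by move=> a lt_an; exact: corner_basis_in.
by move=> u; exact: corner_sum.
Qed.

Definition corner_proj (e : nat -> S) (n : nat) (c : nat -> S^o) : nat -> S^o :=
  fun a => if (a < n)%N then (c a : S) * e a else 0.

Lemma corner_proj_in e n c : (forall a, e a * e a = e a) ->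
  corner e n (corner_proj e n c).
Proof.
move=> ee; split=> a; rewrite /corner_proj; first by rewrite leqNgt => /negPf->.
by case: ifP; rewrite ?mul0r // -mulrA ee.
Qed.

Lemma combination_corner_proj (V : lmodType S) e n (x : nat -> V) (c : nat -> S^o) :
    (forall a, (a < n)%N -> e a *: x a = x a) ->
  combination n x (corner_proj e n c) = combination n x c.
Proof.
move=> ex; apply: eq_bigr => a _.
by rewrite /corner_proj ltn_ord -scalerA ex.
Qed.

End Submodules.

(** * Modules over semiperfect rings *)

Section SemiperfectModules.
Variable S : pzRingType.

(** Modulo the radical every submodule of a free module of rank [q] is a direct
    summand, and a projection onto it lifts to a map [u |-> sum_a u_a k_a] of the
    free module into [K]. The coordinates are split off one at a time, each by a
    complement of the left ideal of the values which it takes on [K]. *)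
Lemma projection_mod_radical (q : nat) (K : (nat -> S^o) -> Prop) :
    semisimple_mod_rad S -> submodule K ->
  exists k : nat -> nat -> S^o, (forall a, K (k a)) /\
    forall u, K u -> forall b, (b < q)%N ->
      jacobson ((u - combination q k u) b : S).
Proof.
move=> ss; elim: q K => [|q IHq] K hK.
  by exists (fun=> 0); split=> // _; exact: submodule0.
pose L (l : S) := exists2 u, K u & jacobson (l - u q : S).
have hL : left_ideal L.
  split=> [|l l' [u Ku Ju] [u' Ku' Ju']|a l [u Ku Ju]].
  - by exists 0; [exact: submodule0 | rewrite subrr; exact: jacobson0].
  - exists (u + u'); first exact: submoduleD.
    by rewrite opprD addrACA; exact: jacobsonD.
  - exists (a *: u); first exact: submoduleZ.
    by rewrite -[(a *: u) q]/(a * u q) -mulrBr; exact: jacobsonM.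
have JL l : jacobson l -> L l.
  by exists 0; [exact: submodule0 | rewrite subr0].
have [L' [[L'0 L'D L'M] JL' Lsum Lcap]] := ss L hL JL.
have [y [z [[k Kk Jk] L'z yz]]] := Lsum 1.
have Ly : L y by exists k.
have hK' : submodule (fun u => K u /\ jacobson (u q : S)).
  split=> [|a u v [Ku Ju] [Kv Jv]].
    by split; [exact: submodule0 | exact: jacobson0].
  by split; [exact: hK.2 | apply: jacobsonD => //; exact: jacobsonM].
have [k' [Kk' k'P]] := IHq _ hK'.
exists (fun a => if a == q then k - combination q k' k else k' a); split.
  move=> a; case: eqP => _; last by case: (Kk' a).
  apply: submoduleB => //; apply: submodule_sum => // b _.
  by apply: submoduleZ => //; case: (Kk' b).
move=> u Ku; set v := u - (u q : S) *: k.
have Jv : jacobson (v q : S).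
  have : jacobson ((u q : S) * z).
    apply: Lcap; last exact: L'M.
    have [_ LD LM] := hL.
    have -> : (u q : S) * z = u q + - u q * y.
      by rewrite -[X in X + _]mulr1 yz mulrDr mulNr addrAC subrr add0r.
    apply: LD; last exact: LM.
    by exists u => //; rewrite subrr; exact: jacobson0.
  have -> : v q = (u q : S) * z + (u q : S) * (y - k q).
    by rewrite -mulrDr addrA [z + y]addrC -yz mulrBr mulr1.
  by move=> Jz; apply: jacobsonD => //; exact: jacobsonM.
have Kv : K v by apply: submoduleB => //; exact: submoduleZ.
have -> : u - combination q.+1
    (fun a => if a == q then k - combination q k' k else k' a) u =
    v - combination q k' v.
  rewrite linearB linearZ /= {1}/combination big_ord_recr /= eqxx.
  rewrite (eq_bigr (fun a : 'I_q => (u a : S) *: k' a)) => [|a _]; last first.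
    by rewrite ifN // neq_ltn ltn_ord.
  rewrite -/(combination q k' u) scalerBr /v opprB opprD opprB.
  by rewrite [LHS](AC (1*(1*2)) ((1*4)*(3*2))).
move=> b; rewrite ltnS leq_eqVlt => /orP[/eqP->|]; last first.
  by move=> lt_bq; exact: k'P.
rewrite -[X in jacobson X]/(v q - (combination q k' v) q).
apply: jacobsonB => //; rewrite /combination fct_sumE.
apply: jacobson_sum => a _; rewrite -[X in jacobson X]/(v a * k' a q).
by apply: jacobsonM; case: (Kk' a).
Qed.

(** Existence of projective covers, in coordinates. The generators are treated
    one after the other: if [L] is the left ideal of the [a] such that [a x_i]
    lies in the span of the previous generators and of the radical of the
    module, then a complement of [L] modulo the radical is generated by an
    idempotent, which is lifted to [e_i]. *)
Lemma minimal_generators (V : lmodType S) (n : nat) (x : nat -> V) :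
    semiperfect S ->
  exists e : nat -> S, [/\ forall a, e a * e a = e a,
    forall i, (i < n)%N -> exists c : nat -> S^o,
      x i = combination n (fun a => e a *: x a) c &
    forall u, corner e n u -> combination n (fun a => e a *: x a) u = 0 ->
      forall a, jacobson (u a : S)].
Proof.
move=> [ss lift].
pose R v := exists2 r : nat -> S^o, forall l, jacobson (r l : S) &
  v = combination n x r.
have hR : submodule R.
  split=> [|a u v [r Jr ->] [s Js ->]].
    by exists 0 => [l|]; [exact: jacobson0 | rewrite linear0].
  exists (a *: r + s); last by rewrite linearP.
  by move=> l; apply: jacobsonD => //; exact: jacobsonM.
have Rx r i : jacobson r -> (i < n)%N -> R (r *: x i).
  move=> Jr lt_in; exists (fun l => if l == i then r else 0) => [l|].
    by case: eqP => // _; exact: jacobson0.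
  rewrite /combination (bigD1 (Ordinal lt_in)) //= eqxx big1 ?addr0 // => l.
  by rewrite -val_eqE /= => /negPf->; rewrite scale0r.
pose m e a : V := e a *: x a.
suff main i : (i <= n)%N -> exists e : nat -> S, [/\ forall a, e a * e a = e a,
    forall a, (a < i)%N -> exists c, R (x a - combination i (m e) c) &
    forall c, R (combination i (m e) c) -> forall a, (a < i)%N ->
      jacobson (c a * e a)].
  have [e [ee xe Je]] := main n (leqnn n); exists e; split=> // [|u [u0 ue] mu a].
    apply: (@nakayama _ _ (fun v => exists c, v = combination n (m e) c)).
    - by exists 0; rewrite linear0.
    - by move=> a u v [c ->] [d ->]; exists (a *: c + d); rewrite linearP.
    move=> i /xe[c [r Jr E]]; exists r; split=> //; exists c.
    by rewrite -/(combination n x r) -E opprB addrC subrK.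
  have [lt_an|le_na] := ltnP a n; last by rewrite u0 //; exact: jacobson0.
  by rewrite -ue; apply: Je => //; rewrite -/(m e) in mu; rewrite mu; case: hR.
elim: i => [_|i IHi lt_in].
  by exists (fun=> 0); split=> // a; rewrite mul0r.
have [e [ee xe Je]] := IHi (ltnW lt_in).
pose L a := exists c, R (a *: x i - combination i (m e) c).
have hL : left_ideal L.
  split=> [|a b [c Rc] [d Rd]|a b [c Rc]].
  - by exists 0; rewrite linear0 scale0r subrr; case: hR.
  - exists (c + d); rewrite linearD scalerDl opprD addrACA.
    exact: submoduleD.
  - exists (a *: c); rewrite linearZ -scalerA -scalerBr /=.
    exact: submoduleZ.
have JL l : jacobson l -> L l.
  by move=> Jl; exists 0; rewrite linear0 subr0; exact: Rx.
have [L' [[L'0 L'D L'M] JL' Lsum Lcap]] := ss L hL JL.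
have [y [z [Ly L'z yz]]] := Lsum 1.
have [e0 [e0e0 Je0]] : exists e0, e0 * e0 = e0 /\ jacobson (e0 - z).
  (* The component of 1 in a complement is idempotent modulo the radical. *)
  apply: lift; have -> : z * z - z = - (z * y).
    by rewrite -[X in _ - X]mulr1 yz mulrDr opprD addrC addrNK.
  apply: jacobsonN; apply: Lcap; first by have [_ _ LM] := hL; exact: LM.
  have -> : z * y = z + (- z) * z.
    by rewrite -[X in X + _]mulr1 yz mulrDr mulNr addrK.
  by apply: L'D => //; exact: L'M.
pose e' a := if a == i then e0 else e a.
have combE c : combination i.+1 (m e') c = combination i (m e) c + c i *: (e0 *: x i).
  rewrite /combination big_ord_recr /= /m /e' eqxx; congr (_ + _).
  by apply: eq_bigr => a _; rewrite ifN // neq_ltn ltn_ord.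
have comb_ext c d : (forall a, (a < i)%N -> c a = d a) ->
    combination i (m e) c = combination i (m e) d.
  by move=> cd; apply: eq_bigr => a _; rewrite cd.
exists e'; split=> [a|a|c Rc].
- by rewrite /e'; case: ifP.
- rewrite ltnS leq_eqVlt => /orP[/eqP->|/[dup] lt_ai /xe[c Rc]].
    have [c Rc] := Ly; exists (fun b => if b == i then 1 else c b).
    rewrite combE eqxx scale1r (comb_ext _ c); last first.
      by move=> b lt_bi; rewrite ifN // neq_ltn lt_bi.
    have -> : x i - (combination i (m e) c + e0 *: x i) =
        (y *: x i - combination i (m e) c) - (e0 - z) *: x i.
      rewrite scalerBl opprB -[X in X - _]scale1r yz scalerDl.
      by rewrite opprD [LHS](AC (2*2) ((1*3)*(2*4))).
    by apply: submoduleB => //; exact: Rx.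
  exists (fun b => if b == i then 0 else c b).
  rewrite combE eqxx scale0r addr0 (comb_ext _ c) // => b lt_bi.
  by rewrite ifN // neq_ltn lt_bi.
have Ji : jacobson (c i * e0).
  apply: Lcap.
    exists (- c); rewrite linearN opprK addrC -scalerA -combE //.
  have -> : c i * e0 = c i * z + c i * (e0 - z) by rewrite mulrBr addrC subrK.
  by apply: L'D; [exact: L'M | apply: JL'; exact: jacobsonM].
move=> a; rewrite ltnS leq_eqVlt => /orP[/eqP->|lt_ai].
  by rewrite /e' eqxx.
rewrite /e' ifN ?neq_ltn ?lt_ai //; apply: Je => //.
have := submoduleB hR Rc (Rx _ _ Ji lt_in).
by rewrite combE scalerA addrK.
Qed.

End SemiperfectModules.

(** * Syzygies over the two rings of a pair with a common radical *)

(** Restriction of scalars. It has the carrier of [U], so that one predicate can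
    be a submodule over both rings. *)
Definition restr (H : pzRingType) (A : subringClosed H) (U : lmodType H) : Type :=
  U.

Section Restriction.
Variables (H : pzRingType) (A : subringClosed H).

Section RestrInstances.
Variable U : lmodType H.

HB.instance Definition _ := GRing.Zmodule.copy (restr A U) U.

Definition restr_scale (a : subring A) (u : restr A U) : restr A U :=
  val a *: (u : U).

Fact restr_scaleA a b u : restr_scale a (restr_scale b u) = restr_scale (a * b) u.
Proof. by rewrite /restr_scale scalerA. Qed.
Fact restr_scale1 : left_id 1 restr_scale.
Proof. by move=> u; rewrite /restr_scale scale1r. Qed.
Fact restr_scaleDr : right_distributive restr_scale +%R.
Proof. by move=> a u v; rewrite /restr_scale scalerDr. Qed.
Fact restr_scaleDl u : {morph restr_scale^~ u : a b / a + b}.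
Proof. by move=> a b; rewrite /restr_scale scalerDl. Qed.

HB.instance Definition _ := GRing.Zmodule_isLmodule.Build (subring A) (restr A U)
  restr_scaleA restr_scale1 restr_scaleDr restr_scaleDl.

End RestrInstances.

Lemma restr_scaleE (U : lmodType H) (a : subring A) (u : restr A U) :
  a *: u = val a *: (u : U).
Proof. by []. Qed.

Lemma submodule_restr (U : lmodType H) (K : U -> Prop) :
  submodule K -> @submodule (subring A) (restr A U) K.
Proof. by case=> K0 KL; split=> // a u v Ku Kv; exact: (KL (val a)). Qed.

Lemma lin_on_restr (U W : lmodType H) (K : U -> Prop) (f : U -> W) :
  lin_on K f -> @lin_on (subring A) (restr A U) (restr A W) K f.
Proof. by move=> fK a u v Ku Kv; exact: (fK (val a)). Qed.


Definition to_subring (h : H) : subring A := insubd (0 : subring A) h.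

Lemma to_subringK h : h \in A -> val (to_subring h) = h.
Proof. by move=> hA; rewrite insubdK. Qed.

Lemma to_subring_lin (a : subring A) h h' : h \in A -> h' \in A ->
  to_subring (val a * h + h') = a * to_subring h + to_subring h'.
Proof.
move=> hA h'A; apply: val_inj; rewrite to_subringK /=.
  by rewrite !to_subringK.
by rewrite rpredD // rpredM // (valP a).
Qed.

Lemma corner_restr_fgp (e : nat -> H) q :
    (forall a, e a \in A) -> (forall a, e a * e a = e a) ->
  fgp_on (fun u : restr A (nat -> H^o) => corner e q u /\ forall a, (u a : H) \in A).
Proof.
move=> eA ee; exists q, (corner_basis e), (fun a u => to_subring (u a)).
split=> [a lt_aq|a b u v [_ uA] [_ vA]|u [cu uA]].
- split=> [|b]; first exact: corner_basis_in.
  by rewrite /corner_basis; case: eqP => // _; exact: rpred0.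
- exact: to_subring_lin.
rewrite {1}(corner_sum cu); apply: eq_bigr => a _.
by rewrite restr_scaleE to_subringK.
Qed.

End Restriction.

Section Cocycles.
Variables (S : pzRingType) (P : complex S).

Definition cocycle (i : int) (x : P i) : Prop := cx_d P i x = 0.

Definition exact_at (i : int) : Prop :=
  forall x : P (i + 1), cocycle x -> exists y, x = cx_d P i y.

Lemma cocycle_submodule i : submodule (@cocycle i).
Proof.
by split=> [|a u v]; rewrite /cocycle ?linear0 // => du dv;
   rewrite linearP du dv scaler0 addr0.
Qed.

Lemma cocycle_fg i : exact_at i -> fgp_on (fun _ : P i => True) ->
  fg_on (@cocycle (i + 1)).
Proof.
move=> ex [n [v [phi [_ _ db]]]]; exists n, (fun a => cx_d P i (v a)).
split=> [a _|x /ex[y ->]]; first exact: cx_dd.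
exists (fun a => phi a y); rewrite {1}(db y I) linear_sum.
by apply: eq_bigr => a _; rewrite linearZ.
Qed.

End Cocycles.

Section Syzygies.
Variables (H : pzRingType) (A : subringClosed H).
Hypothesis hHA : backstrom_pair A.

Lemma jacobson_in_subring (x : H) : jacobson x -> x \in A.
Proof. by case: hHA => _ _ /(_ x)[+ _] => /[apply] -[a [<- _]]; exact: valP. Qed.

Lemma jacobson_val (a : subring A) : jacobson a -> jacobson (val a).
Proof. by case: hHA => _ _ /(_ (val a))[_ +] Ja; apply; exists a. Qed.

Lemma jacobson_conductor (x : H) : jacobson x -> x \in conductor A.
Proof.
move=> Jx; apply/conductorP; split=> [|h]; apply: jacobson_in_subring => //.
exact: jacobsonM.
Qed.

Variable P : complex (subring A).
Hypothesis fgpP : forall i, fgp_on (fun _ : P i => True).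

Definition minimal_kernel (U : lmodType H) (e : nat -> H) q (m : nat -> U)
    (u : nat -> H^o) : Prop :=
  [/\ corner e q u, forall a, jacobson (u a : H) & combination q m u = 0].

(** The kernel of a minimal cover lies in the radical, which is an ideal of the
    larger ring. Hence a syzygy over [A] of a submodule of an [H]-module is an
    [H]-module. *)
Lemma minimal_kernel_submodule (U : lmodType H) e q (m : nat -> U) :
  submodule (minimal_kernel e q m).
Proof.
have [c0 cL] := @corner_submodule _ e q.
split=> [|h u v [cu Ju mu] [cv Jv mv]].
  by split=> // [a|]; [exact: jacobson0 | rewrite linear0].
split; first exact: cL.
  by move=> a; apply: jacobsonD; [exact: jacobsonM|].
by rewrite linearP /= mu mv scaler0 addr0.
Qed.

(** [N] is covered over [A] as economically as possible. By Schanuel's lemma the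
    kernel inherits from [N] its relation to the cocycles of [P], one degree
    further to the left. *)
Lemma minimal_cover (U : lmodType H) (N : restr A U -> Prop) (i : int) :
    submodule N -> exact_at P i -> stable_retract N (@cocycle _ P (i + 1)) ->
  exists q (e : nat -> H) (m : nat -> U),
    [/\ forall a, e a \in A, forall a, e a * e a = e a &
        forall a, e a *: m a = m a] /\
    [/\ forall a, (a < q)%N -> N (m a),
        forall u, corner e q u -> (forall a, (u a : H) \in A) ->
          combination q m u = 0 -> minimal_kernel e q m u,
        forall w, N w -> exists2 c : nat -> H^o,
          forall a, (c a : H) \in A & w = combination q m c &
        stable_retract (minimal_kernel e q m : restr A (nat -> H^o) -> Prop)
          (@cocycle _ P i)].
Proof.
move=> hN ex srN.
have [q [x [Nx gx]]] : fg_on N.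
  apply: stable_retract_fg srN _; first exact: cocycle_submodule.
  exact: cocycle_fg.
have [_ spA _] := hHA.
have [eA [eAe xe Je]] := minimal_generators q x spA.
pose e a := val (eA a); pose m a : U := e a *: (x a : U).
have ee a : e a * e a = e a by have /(congr1 val) := eAe a.
have combA (c : nat -> (subring A)^o) :
    combination q (fun a => eA a *: x a) c =
    combination q m (fun a => val (c a : subring A)) by [].
have Nm a : (a < q)%N -> N (m a).
  by move=> lt_aq; apply: (submoduleZ hN (eA a)); exact: Nx.
have gm w : N w -> exists2 c : nat -> H^o,
    forall a, (c a : H) \in A & w = combination q m c.
  move=> /gx[c ->].
  have /choice[d xd] : forall a : 'I_q, exists d : nat -> (subring A)^o,
      x a = combination q (fun a => eA a *: x a) d by move=> a; exact: xe.
  exists (fun b => val (\sum_(a < q) (c a : subring A) * d a b)).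
    by move=> a; exact: valP.
  rewrite -(combA (fun b => \sum_(a < q) (c a : subring A) * d a b)).
  rewrite /combination; under eq_bigr do rewrite xd scaler_sumr.
  rewrite exchange_big; apply: eq_bigr => b _ /=.
  by rewrite scaler_suml; apply: eq_bigr => a _; rewrite scalerA.
exists q, e, m; split; first split=> // [a|a]; first exact: valP.
  by rewrite scalerA ee.
have kerJ u : corner e q u -> (forall a, (u a : H) \in A) ->
    combination q m u = 0 -> minimal_kernel e q m u.
  move=> cu uA mu; split=> // a; rewrite -[u a](@to_subringK _ A) //.
  apply: jacobson_val.
  have uE : (fun b => val (to_subring A (u b))) = u.
    by apply/funext => b; exact: to_subringK.
  apply: (Je (fun b => to_subring A (u b))); last by rewrite combA uE.
  have [u0 ue] := cu; split=> b => [/u0 ->|]; apply: val_inj.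
    by rewrite to_subringK // rpred0.
  by rewrite /= to_subringK // ue.
split=> //.
pose F (u : restr A (nat -> H^o)) := corner e q u /\ forall a, (u a : H) \in A.
have hF : submodule F.
  split=> [|a u v [cu uA] [cv vA]].
    by split=> [|b]; [case: (@corner_submodule _ e q) | exact: rpred0].
  split=> [|b]; first exact: (@corner_submodule _ e q).2.
  by apply: rpredD => //; apply: rpredM => //; exact: valP.
have -> : (minimal_kernel e q m : restr A (nat -> H^o) -> Prop) =
    (fun u => F u /\ combination q m u = 0).
  apply/funext => u; apply/propext; split=> [[cu Ju mu]|[[cu uA] mu]].
    by split=> //; split=> // a; exact: jacobson_in_subring.
  exact: kerJ.
have -> : @cocycle _ P i = (fun x => True /\ cx_d P i x = 0).
  by apply/funext => x'; apply/propext; split=> [|[]].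
apply: (@stable_retract_ker (subring A) (restr A (nat -> H^o)) (P i) (restr A U)
  (P (i + 1)) F (fun=> True) N (@cocycle _ P (i + 1))) => //.
- exact: cocycle_submodule.
- by apply: corner_restr_fgp => // a; exact: valP.
- exact/(@lin_on_restr _ A)/lin_on_linear.
- exact: lin_on_linear.
- move=> u [cu uA]; apply: (submodule_sum hN) => a _.
  by rewrite -[u a](@to_subringK _ A) //; apply: (submoduleZ hN); exact: Nm.
- move=> w /gm[c cA ->].
  have exm a : e a *: m a = m a by rewrite scalerA ee.
  exists (corner_proj e q c); last first.
    by apply: (@combination_corner_proj H U) => a _.
  split=> [|a]; first exact: corner_proj_in.
  by rewrite /corner_proj; case: ifP => _; rewrite ?rpred0 // rpredM //; exact: valP.
- by move=> x' _; exact: cx_dd.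
- by move=> w /ex[y ->]; exists y.
Qed.

Definition syzygy (r : nat) (x : nat -> nat -> H^o) (u : nat -> H^o) : Prop :=
  corner (fun=> 1) r u /\ combination r x u = 0.

Variable j : int.
Hypothesis exactP : forall i : int, (i <= j)%R -> exact_at P i.

(** Up to free summands, [K] is an [H]-module [M] which over [A] is, again up to
    free summands, a syzygy occurring in [P]. The two steps cannot be merged,
    since a free [H]-module need not be finitely generated over [A]. *)
Definition tame (K : (nat -> H^o) -> Prop) : Prop :=
  submodule K /\ exists M : (nat -> H^o) -> Prop,
  [/\ submodule M, stable_retract K M & exists2 i : int, (i <= j)%R &
      stable_retract (M : restr A (nat -> H^o) -> Prop) (@cocycle _ P i)].

(** A minimal cover of [M] over [A] extends to a cover of [M] over [H].
    The kernel of the latter exceeds the [A]-syzygy only by its image modulo the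
    radical. As this image is a direct summand, the kernel is a stable retract of
    the [A]-syzygy, which serves as the module [M] of the next step. *)
Lemma tame_syzygy K : tame K ->
  exists r x, generates_on K r x /\ tame (syzygy r x).
Proof.
move=> [hK [M [hM srKM [i le_ij srMP]]]].
have := srMP; rewrite -(subrK 1 i) => srMP'.
have ex : exact_at P (i - 1) by apply: exactP; lia.
have [q [e [m [[eA ee em] [Mm _ gm srker]]]]] :=
  minimal_cover (submodule_restr A hM) ex srMP'.
have [r [x [Kx gx]]] : fg_on K.
  apply: stable_retract_fg srKM _ => //; exists q, m; split=> // u /gm[c _ ->].
  by exists c.
exists r, x; split=> //.
pose G (u : nat -> H^o) := corner e q u.
have hG : submodule G := @corner_submodule _ e q.
have hF : submodule (corner (fun=> 1 : H) r) := @corner_submodule _ _ r.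
have h1 (a : nat) : 1 * 1 = 1 :> H by rewrite mulr1.
split; first exact: (submodule_ker hF (@lin_on_linear _ _ _ _ (combination r x))).
exists (minimal_kernel e q m); split; first exact: minimal_kernel_submodule.
  have hK2 : submodule (fun u => G u /\ combination q m u = 0).
    exact: (submodule_ker hG (@lin_on_linear _ _ _ _ (combination q m))).
  apply: (@stable_retract_trans _ _ _ _ _ (fun u => G u /\ combination q m u = 0)).
  - exact: (submodule_ker hF (@lin_on_linear _ _ _ _ (combination r x))).
  - exact: hK2.
  - apply: (@stable_retract_ker _ _ _ _ _ (corner (fun=> 1) r) G K M) => //.
    + exact: corner_fgp.
    + exact: corner_fgp.
    + exact: lin_on_linear.
    + exact: lin_on_linear.
    + by move=> u _; exact: combination_in.
    + move=> w /gx[c ->]; exists (corner_proj (fun=> 1) r c).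
        exact: corner_proj_in.
      by apply: combination_corner_proj => a _; rewrite scale1r.
    + by move=> u _; exact: combination_in.
    + move=> w /gm[c _ ->]; exists (corner_proj e q c); first exact: corner_proj_in.
      by apply: combination_corner_proj => a _.
  have [[ssH _] _ _] := hHA.
  have [k [Kk kP]] := projection_mod_radical q ssH hK2.
  exists (fun u => u - combination q k u), id, 'I_q.
  exists (fun (a : 'I_q) (u : nat -> H^o) => (u a : H)), (fun a : 'I_q => k a).
  have comb2 u := @combination_in _ _ _ q k u hK2 (fun a _ => Kk a).
  split=> [|||u _]; last by rewrite subrK.
  - split=> [a u v _ _|u [Gu mu]].
      by rewrite linearP scalerBr opprD addrACA.
    have [G2 m2] := submoduleB hK2 (conj Gu mu) (comb2 u).
    split=> // a; have [lt_aq|le_qa] := ltnP a q; first exact: (kP u).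
    case: G2 => G20 _; rewrite [X in jacobson X]G20 //; exact: jacobson0.
  - by split=> // u [].
  - by split=> // a.
by exists (i - 1) => //; lia.
Qed.

(** Iterating the previous step resolves a tame module by free modules of finite
    rank. *)
Lemma tame_resolution K : tame K ->
  exists (r : nat -> nat) (x : nat -> nat -> nat -> H^o),
    generates_on K (r 0) (x 0) /\
    forall t, generates_on (syzygy (r t) (x t)) (r t.+1) (x t.+1).
Proof.
move=> /tame_syzygy[r0 [x0 [g0 tm0]]].
pose stage := {rx : nat * (nat -> nat -> H^o) | tame (syzygy rx.1 rx.2)}.
have /choice[next nextP] : forall s : stage, exists s' : stage,
    generates_on (syzygy (sval s).1 (sval s).2) (sval s').1 (sval s').2.
  move=> [[r x] /= /tame_syzygy[r' [x' [g' tm']]]].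
  by exists (exist _ (r', x') tm').
pose s t := iter t next (exist _ (r0, x0) tm0 : stage).
by exists (fun t => (sval (s t)).1), (fun t => (sval (s t)).2); split.
Qed.

End Syzygies.

(** * The derived category *)

Section DerivedCategory.
Variable S : pzRingType.
Implicit Types X Y Z : complex S.

Lemma is_der_iso_id X : is_der_iso (der_id X).
Proof. by exists (der_id X); split; exact: der_eq_idl. Qed.

Lemma is_der_iso_map X Y (s : chain_map X Y) (qs : quasi_iso s) :
  is_der_iso (der_map s).
Proof. by exists (der_inv qs); split; [exact: der_eq_invr | exact: der_eq_invl]. Qed.

Lemma der_eq_cancel X Y Z T (f : der_hom X Y) (g : der_hom Y Z) (g' : der_hom Z Y)
    (h : der_hom Y T) :
  der_eq (der_comp g g') (der_id Y) ->
  der_eq (der_comp (der_comp f g) (der_comp g' h)) (der_comp f h).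
Proof.
move=> E; apply: der_eq_trans (der_eq_sym (der_eq_assoc _ _ _)) _.
apply: der_eq_comp (der_eq_refl _) _; apply: der_eq_trans (der_eq_assoc _ _ _) _.
by apply: der_eq_trans (der_eq_comp E (der_eq_refl _)) _; exact: der_eq_idl.
Qed.

Lemma is_der_iso_comp X Y Z (f : der_hom X Y) (g : der_hom Y Z) :
  is_der_iso f -> is_der_iso g -> is_der_iso (der_comp f g).
Proof.
move=> [f' [ff' f'f]] [g' [gg' g'g]]; exists (der_comp g' f'); split.
  exact: der_eq_trans (der_eq_cancel _ _ gg') ff'.
exact: der_eq_trans (der_eq_cancel _ _ f'f) g'g.
Qed.

Lemma der_iso_refl X : der_iso X X.
Proof. by exists (der_id X); exact: is_der_iso_id. Qed.

Lemma der_iso_sym X Y : der_iso X Y -> der_iso Y X.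
Proof. by move=> [f [g [fg gf]]]; exists g, f. Qed.

Lemma der_iso_trans X Y Z : der_iso X Y -> der_iso Y Z -> der_iso X Z.
Proof.
by move=> [f fP] [g gP]; exists (der_comp f g); exact: is_der_iso_comp.
Qed.

Lemma der_iso_map X Y (s : chain_map X Y) : quasi_iso s -> der_iso X Y.
Proof. by move=> qs; exists (der_map s); exact: is_der_iso_map. Qed.

Lemma quasi_iso_bij X Y (f : chain_map X Y) :
    (forall i (x : X i), f i x = 0 -> x = 0) ->
    (forall i (y : Y i), exists x, f i x = y) ->
  quasi_iso f.
Proof.
move=> finj fsurj i; split=> [x _ [y fx]|y dy].
  have [x' fx'] := fsurj _ y; exists x'; apply/subr0_eq/finj.
  by rewrite linearB fx cm_comm fx' subrr.
have [x fx] := fsurj _ y; exists x; split; last first.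
  by exists 0; rewrite linear0 addr0.
by apply: finj; rewrite cm_comm fx.
Qed.

(** The effect of a morphism of the derived category on cohomology classes, as
    a correspondence between cocycles; a formal inverse acts backwards. *)
Fixpoint coh_rel X Y (f : der_hom X Y) (i : int) : X (i + 1) -> Y (i + 1) -> Prop :=
  match f in der_hom X Y return X (i + 1) -> Y (i + 1) -> Prop with
  | der_map _ Y f => fun x y => exists t, f (i + 1) x = y + cx_d Y i t
  | der_inv _ Y s _ => fun y x => exists t, s (i + 1) x = y + cx_d Y i t
  | der_comp _ _ _ f g => fun x z => exists y,
      [/\ cocycle y, @coh_rel _ _ f i x y & @coh_rel _ _ g i y z]
  end.

Definition cohomologous X (i : int) (x x' : X (i + 1)) : Prop :=
  exists t, x = x' + cx_d X i t.

Lemma cohomologous_refl X i (x : X (i + 1)) : cohomologous x x.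
Proof. by exists 0; rewrite linear0 addr0. Qed.

Lemma cohomologous_sym X i (x x' : X (i + 1)) :
  cohomologous x x' -> cohomologous x' x.
Proof. by case=> t ->; exists (- t); rewrite linearN addrK. Qed.

Lemma cohomologous_trans X i (x y z : X (i + 1)) :
  cohomologous x y -> cohomologous y z -> cohomologous x z.
Proof. by case=> t -> [u ->]; exists (u + t); rewrite linearD addrA. Qed.

Lemma cohomologous_map X Y (f : chain_map X Y) i (x y : X (i + 1)) :
  cohomologous x y -> cohomologous (f (i + 1) x) (f (i + 1) y).
Proof. by case=> t ->; exists (f i t); rewrite linearD cm_comm. Qed.

Lemma coh_rel_total X Y (f : der_hom X Y) i (x : X (i + 1)) :
  cocycle x -> exists2 y, cocycle y & coh_rel f x y.
Proof.
elim: f x => {X Y} [X Y f|X Y s qs|X Y Z f IHf g IHg] x dx /=.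
- exists (f (i + 1) x); last by exists 0; rewrite linear0 addr0.
  by rewrite /cocycle -cm_comm dx linear0.
- have [_ /(_ x dx)[y [dy [t ->]]]] := qs i; exists y => //.
  by exists (- t); rewrite linearN addrK.
- have [y dy fxy] := IHf x dx; have [z dz gyz] := IHg y dy.
  by exists z => //; exists y.
Qed.

Lemma coh_rel_fun X Y (f : der_hom X Y) i (x x' : X (i + 1)) (y y' : Y (i + 1)) :
    cocycle y -> cocycle y' -> cohomologous x x' ->
  coh_rel f x y -> coh_rel f x' y' -> cohomologous y y'.
Proof.
elim: f x x' y y' => {X Y} [X Y f|X Y s qs|X Y Z f IHf g IHg] x x' y y' dy dy' xx' /=.
- move=> fxy fxy'; apply: cohomologous_trans (cohomologous_sym fxy) _.
  exact: cohomologous_trans (cohomologous_map f xx') fxy'.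
- move=> sxy sxy'; have [t st] : cohomologous (s (i + 1) y) (s (i + 1) y').
    apply: cohomologous_trans sxy _; apply: cohomologous_trans xx' _.
    exact: cohomologous_sym.
  have dyy' : cx_d X (i + 1) (y - y') = 0 by rewrite linearB /= dy dy' subrr.
  have [inj_s _] := qs i; have [|u yy'] := inj_s _ dyy'.
    by exists t; rewrite linearB /= st [_ + cx_d _ _ _]addrC addrK.
  by exists u; rewrite -yy' addrCA subrr addr0.
- move=> [z [dz xz zy]] [z' [dz' xz' zy']].
  exact: (IHg z z') (IHf x x' z z' _ _ _ _ _) zy zy'.
Qed.

Lemma coh_rel_stable X Y (f : der_hom X Y) i (x x' : X (i + 1)) (y y' : Y (i + 1)) :
    cocycle x -> cocycle x' -> cocycle y -> cocycle y' ->
    cohomologous x x' -> cohomologous y y' ->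
  coh_rel f x y -> coh_rel f x' y'.
Proof.
elim: f x x' y y' => {X Y} [X Y f|X Y s qs|X Y Z f IHf g IHg] x x' y y'
  dx dx' dy dy' xx' yy' /=.
- move=> xy; apply: cohomologous_trans yy'.
  apply: cohomologous_trans xy; apply: cohomologous_map.
  exact: cohomologous_sym.
- move=> xy; apply: cohomologous_trans xx'.
  apply: cohomologous_trans xy; apply: cohomologous_map.
  exact: cohomologous_sym.
- have refl := cohomologous_refl.
  by move=> [z [dz xz zy]]; exists z; split=> //; [exact: IHf xz | exact: IHg zy].
Qed.

Lemma coh_rel_eq X Y (f g : der_hom X Y) : der_eq f g ->
  forall i (x : X (i + 1)) (y : Y (i + 1)), cocycle x -> cocycle y ->
  coh_rel f x y <-> coh_rel g x y.
Proof.
have refl := cohomologous_refl; elim=> {X Y f g} /=.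
- by [].
- by move=> X Y f g _ IH i x y dx dy; apply: iff_sym; exact: IH.
- by move=> X Y f g h _ IHf _ IHg i x y dx dy; rewrite IHf // IHg.
- move=> X Y Z f f' g g' _ IHf _ IHg i x z dx dz.
  by split=> -[y [dy fxy gyz]]; exists y; split=> //; apply/IHf || apply/IHg.
- move=> X Y Z T f g h i x t dx dt; split.
    by move=> [y [dy xy [z [dz yz zt]]]]; exists z; split=> //; exists y.
  by move=> [z [dz [y [dy xy yz]] zt]]; exists y; split=> //; exists z.
- move=> X Y f i x y dx dy; split=> [[x' [dx' xx' x'y]]|xy].
    exact: coh_rel_stable (cohomologous_sym xx') (refl _ _ _) x'y.
  by exists x; split=> //; exact: refl.
- move=> X Y f i x y dx dy; split=> [[y' [dy' xy' y'y]]|xy].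
    exact: coh_rel_stable (refl _ _ _) y'y xy'.
  by exists y; split=> //; exact: refl.
- by move=> X Y f g fg i x y dx dy; rewrite fg.
- move=> X Y Z f g i x z dx dz; split=> [[y [dy xy yz]]|xz].
    exact: cohomologous_trans (cohomologous_map g xy) yz.
  exists (f (i + 1) x); split=> //; last exact: refl.
  by rewrite /cocycle -cm_comm dx linear0.
- move=> X Y s qs i x y dx dy; split=> [[z [dz xz zy]]|xy].
    exact: cohomologous_trans (cohomologous_sym xz) zy.
  have [z dz zx] := coh_rel_total (der_inv qs) dx.
  by exists z; split=> //; exact: cohomologous_trans zx xy.
- move=> X Y s qs i x y dx dy; split=> [[z [dz xz yz]]|xy].
    have := coh_rel_fun (f := der_inv qs) dx dy _ xz yz.
    by apply; exact: refl.
  exists (s (i + 1) x); split; last 2 first.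
  + exact: refl.
  + by apply: cohomologous_map; exact: cohomologous_sym.
  by rewrite /cocycle -cm_comm dx linear0.
Qed.

Lemma coh_rel0 X Y (f : der_hom X Y) i : coh_rel f (0 : X (i + 1)) 0.
Proof.
elim: f => {X Y} [X Y f|X Y s qs|X Y Z f IHf g IHg] /=.
- by exists 0; rewrite !linear0 addr0.
- by exists 0; rewrite !linear0 addr0.
- by exists 0; split=> //; rewrite /cocycle linear0.
Qed.

(** A class of [X] equals its image under the composite [X -> Y -> X], and this
    factors through a cohomology group of [Y]. *)
Lemma exact_at_der_iso X Y i : der_iso X Y -> exact_at Y i -> exact_at X i.
Proof.
move=> [f [g [fg _]]] exY x dx.
have [y dy fxy] := coh_rel_total f dx; have [z dz gyz] := coh_rel_total g dy.
have [t xz] : cohomologous x z by apply: (coh_rel_eq fg dx dz).1; exists y.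
have d0 : cocycle (0 : X (i + 1)) by rewrite /cocycle linear0.
have [u z0] : cohomologous z 0.
  have [w yw] := exY y dy.
  apply: coh_rel_fun dz d0 _ gyz (coh_rel0 g i).
  by exists w; rewrite add0r.
by exists (u + t); rewrite xz z0 linearD add0r.
Qed.

End DerivedCategory.

(** * Generation *)

Section Generation.
Variable S : pzRingType.
Implicit Types X Y Z : complex S.

Definition dsum0_in X (i : int) (x : X i) : X i * zero_complex S i := (x, 0).

Fact dsum0_in_linear X i : linear (@dsum0_in X i).
Proof.
by move=> a u v; apply: injective_projections; rewrite //= scaler0 addr0.
Qed.

HB.instance Definition _ X i :=
  GRing.isLinear.Build S _ _ *:%R (@dsum0_in X i) (@dsum0_in_linear X i).

Program Definition cm_dsum0 X : chain_map X (dsum X (zero_complex S)) :=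
  @ChainMap _ X (dsum X (zero_complex S)) (fun i => @dsum0_in X i) _.

Lemma der_iso_dsum0 X : der_iso X (dsum X (zero_complex S)).
Proof.
apply: (@der_iso_map _ _ _ (cm_dsum0 X)); apply: quasi_iso_bij => i.
  by move=> x /(congr1 fst).
by move=> [x z]; exists x; rewrite /= /dsum0_in [z]thinmx0.
Qed.

Lemma Dfb_zero : Dfb (zero_complex S).
Proof.
split; first by exists 0, 0 => i _ x _; exists 0; rewrite [x]thinmx0 linear0.
exists (zero_complex S); split; last exact: der_iso_refl.
  move=> i; split.
    exists 0%N, (fun=> 0) => x; exists (fun=> 0).
    by rewrite [x]thinmx0 big_ord0.
  move=> M N g f _; exists (\0 : {linear _ -> _}) => x.
  by rewrite [x]thinmx0 !linear0.
by exists 0 => i _ x; exact: thinmx0.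
Qed.

Section Closure.
Variable T : complex S -> Prop.

Lemma add_closure_sub M X : add_closure T M X -> T X.
Proof. by case. Qed.

Lemma gen_succ_sub M k X : gen_succ T M k X -> T X.
Proof. by case: k => [|k] /=; exact: add_closure_sub. Qed.

(** The definition of the closure only provides isomorphisms to sums and shifts;
    the sum with zero yields all others. *)
Lemma add_closure_iso M X Y : T (zero_complex S) -> T Y -> der_iso Y X ->
  add_closure T M X -> add_closure T M Y.
Proof.
move=> T0 TY YX aX.
have a0 : add_closure T M (zero_complex S).
  by apply: add_zero => //; exact: der_iso_refl.
by apply: (add_dsum TY aX a0); exact: der_iso_trans YX (der_iso_dsum0 X).
Qed.

Lemma gen_succ_iso M k X Y : T (zero_complex S) -> T Y -> der_iso Y X ->
  gen_succ T M k X -> gen_succ T M k Y.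
Proof. by case: k => [|k] /=; exact: add_closure_iso. Qed.

End Closure.
End Generation.

(** * The functor given by the first column *)

#[local] Hint Resolve der_eq_refl : core.

#[local] Instance der_eq_equiv (S : pzRingType) (X Y : complex S) :
  Equivalence (@der_eq S X Y).
Proof.
split; [exact: der_eq_refl | exact: der_eq_sym | exact: der_eq_trans].
Qed.

#[local] Instance der_comp_proper (S : pzRingType) (X Y Z : complex S) :
  Proper (@der_eq S X Y ==> @der_eq S Y Z ==> @der_eq S X Z) (@der_comp S X Y Z).
Proof. by move=> f f' ff' g g' gg'; exact: der_eq_comp. Qed.

Section ColumnFunctor.
Variables (H : pzRingType) (A : subringClosed H).
Notation E := (envelope A).

Fact first_column_proof : \col_(i < 2) (i == ord0)%:R \in column_shape A.
Proof. by rewrite inE /= !mxE /= rpred1 conductor0. Qed.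

(** This generates the first column over the envelope. *)
Definition first_column : column A := Column first_column_proof.

Definition pad_fun (p : 'cV[H]_2) : 'M[H]_2 :=
  \matrix_(i, j) (if j == ord0 then p i ord0 else 0).

Fact pad_proof (p : column A) : pad_fun (val p) \in envelope_shape A.
Proof. by case: p => p pP; rewrite inE /= !mxE. Qed.

(** The first column as a left ideal of the envelope. *)
Definition pad (p : column A) : E := Envelope (pad_proof p).

Lemma pad_scale (a : E) (p : column A) : pad (a *: p) = a * pad p.
Proof.
apply: val_inj; apply/matrixP => i j; rewrite /= !mxE.
case: eqP => [->|/eqP/negPf ne]; rewrite ?mxE.
  by apply: eq_bigr => k _; rewrite !mxE eqxx.
by rewrite big1 // => k _; rewrite !mxE ne mulr0.
Qed.

Lemma padD (p q : column A) : pad (p + q) = pad p + pad q.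
Proof.
by apply: val_inj; apply/matrixP => i j; rewrite /= !mxE; case: eqP;
   rewrite ?mxE ?addr0.
Qed.

Lemma pad_first_column (p : column A) : pad p *: first_column = p.
Proof.
apply: val_inj; apply/matrixP => i j; rewrite /= !mxE sum_ord2 !mxE /=.
by rewrite mulr1 mul0r addr0 [j]ord1.
Qed.

Definition hom_of_fun (M : lmodType E) (m : M) (p : column A) : M := pad p *: m.

Fact hom_of_linear (M : lmodType E) (m : M) : linear (@hom_of_fun M m).
Proof.
by move=> a p q; rewrite /hom_of_fun padD pad_scale scalerDl scalerA.
Qed.

HB.instance Definition _ (M : lmodType E) (m : M) :=
  GRing.isLinear.Build E (column A) M *:%R (@hom_of_fun M m) (@hom_of_linear M m).

Definition hom_of (M : lmodType E) (m : M) : hom_column M :=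
  @hom_of_fun M m : {linear column A -> M}.

Lemma hom_of_first_column (M : lmodType E) (f : hom_column M) :
  f = hom_of ((f : {linear _ -> _}) first_column).
Proof.
apply: hom_column_ext => p; rewrite -[p in LHS]pad_first_column.
exact: linearZ.
Qed.

Lemma hom_column_map_of (M N : lmodType E) (g : {linear M -> N}) m :
  hom_column_map g (hom_of m) = hom_of (g m).
Proof. by apply: hom_column_ext => p; exact: linearZ. Qed.

Lemma hom_ofD (M : lmodType E) (m n : M) :
  hom_of (m + n) = hom_of m + hom_of n.
Proof. by apply: hom_column_ext => p; exact: scalerDr. Qed.

Section OnMaps.
Implicit Types X Y Z : complex E.

Program Definition DF_map X Y (f : chain_map X Y) : chain_map (DF X) (DF Y) :=
  @ChainMap _ (DF X) (DF Y) (fun i => hom_column_map (f i)) _.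
Next Obligation. by apply: hom_column_ext => p; exact: cm_comm. Qed.

(** The functor is exact, since evaluation at the generator of the column
    identifies it with multiplication by the first matrix unit. *)
Lemma quasi_iso_DF X Y (f : chain_map X Y) : quasi_iso f -> quasi_iso (DF_map f).
Proof.
move=> qf i; have [fi fs] := qf i.
pose ev (M : lmodType E) (x : hom_column M) := (x : {linear _ -> _}) first_column.
split=> [x dx [y fx]|y dy].
  have dx1 : cx_d X (i + 1) (ev _ x) = 0 by rewrite -[RHS]/(ev _ 0) -dx.
  have [|x' E'] := fi _ dx1.
    by exists (ev _ y); rewrite -[RHS]/(ev _ (cx_d (DF Y) i y)) -fx.
  exists (hom_of x'); rewrite [LHS]hom_of_first_column -/(ev _ x) E'.
  by rewrite -hom_column_map_of.
have dy1 : cx_d Y (i + 1) (ev _ y) = 0 by rewrite -[RHS]/(ev _ 0) -dy.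
have [x [dx [y' E']]] := fs _ dy1.
exists (hom_of x); split.
  rewrite /= hom_column_map_of dx; apply: hom_column_ext => p; exact: scaler0.
exists (hom_of y'); rewrite [LHS]hom_of_first_column -/(ev _ y) E' hom_ofD.
by rewrite -!hom_column_map_of.
Qed.

Fixpoint DF_hom X Y (f : der_hom X Y) : der_hom (DF X) (DF Y) :=
  match f with
  | der_map _ _ f => der_map (DF_map f)
  | der_inv _ _ _ qs => der_inv (quasi_iso_DF qs)
  | der_comp _ _ _ f g => der_comp (DF_hom f) (DF_hom g)
  end.

Lemma DF_hom_id X : der_eq (DF_hom (der_id X)) (der_id (DF X)).
Proof. by apply: der_eq_ext => i f; exact: hom_column_ext. Qed.

Lemma DF_hom_eq X Y (f g : der_hom X Y) : der_eq f g -> der_eq (DF_hom f) (DF_hom g).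
Proof.
elim=> {X Y f g} /=.
- by move=> *; exact: der_eq_refl.
- by move=> X Y f g _; exact: der_eq_sym.
- by move=> X Y f g h _ fg _; exact: der_eq_trans.
- by move=> X Y Z f f' g g' _ ff' _; exact: der_eq_comp.
- by move=> *; exact: der_eq_assoc.
- by move=> X Y f; rewrite [der_map _]DF_hom_id; exact: der_eq_idl.
- by move=> X Y f; rewrite [der_map _]DF_hom_id; exact: der_eq_idr.
- move=> X Y f g fg; apply: der_eq_ext => i u; apply: hom_column_ext => p.
  exact: fg.
- move=> X Y Z f g; rewrite der_eq_map; apply: der_eq_ext => i u.
  exact: hom_column_ext.
- move=> X Y s qs; exact: der_eq_trans (der_eq_invl _) (der_eq_sym (DF_hom_id _)).
- move=> X Y s qs; exact: der_eq_trans (der_eq_invr _) (der_eq_sym (DF_hom_id _)).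
Qed.

Lemma is_der_iso_DF X Y (f : der_hom X Y) : is_der_iso f -> is_der_iso (DF_hom f).
Proof.
move=> [g [fg gf]]; exists (DF_hom g); split.
  exact: der_eq_trans (DF_hom_eq fg) (DF_hom_id X).
exact: der_eq_trans (DF_hom_eq gf) (DF_hom_id Y).
Qed.

Lemma der_iso_DF X Y : der_iso X Y -> der_iso (DF X) (DF Y).
Proof. by move=> [f fP]; exists (DF_hom f); exact: is_der_iso_DF. Qed.

Program Definition DF_shift X : chain_map (DF (shift X)) (shift (DF X)) :=
  @ChainMap _ (DF (shift X)) (shift (DF X)) (fun i => idfun) _.
Next Obligation. exact: hom_column_ext. Qed.

Lemma quasi_iso_DF_shift X : quasi_iso (DF_shift X).
Proof. by apply: quasi_iso_bij => [//|i y]; exists y. Qed.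

Program Definition DF_zero_map :
    chain_map (DF (zero_complex E)) (zero_complex (subring A)) :=
  @ChainMap _ (DF (zero_complex E)) (zero_complex (subring A))
    (fun i => \0 : {linear _ -> _}) _.

Lemma DF_zero : der_iso (DF (zero_complex E)) (zero_complex (subring A)).
Proof.
apply: (@der_iso_map _ _ _ DF_zero_map); apply: quasi_iso_bij => i x.
  by move=> _; apply: hom_column_ext => p; exact: thinmx0.
by exists 0; rewrite [RHS]thinmx0.
Qed.

Section Pairs.
Variables M N : lmodType E.

Definition hom_split (f : hom_column (M * N)%type) : hom_column M * hom_column N :=
  (hom_column_map fst f, hom_column_map snd f).

Fact hom_split_linear : linear hom_split.
Proof. by move=> a f g; rewrite /hom_split !linearP. Qed.

HB.instance Definition _ := GRing.isLinear.Build (subring A) _ _ *:%R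
  hom_split hom_split_linear.

Lemma hom_split_inj f : hom_split f = 0 -> f = 0.
Proof.
move=> f0; apply: hom_column_ext => p; apply: injective_projections.
  exact: (congr1 (fun g => (g.1 : {linear column A -> M}) p) f0).
exact: (congr1 (fun g => (g.2 : {linear column A -> N}) p) f0).
Qed.

Lemma hom_split_surj g : exists f, hom_split f = g.
Proof.
pose ev (L : lmodType E) (x : hom_column L) := (x : {linear _ -> _}) first_column.
exists (hom_of (ev _ g.1, ev _ g.2)); rewrite /hom_split !hom_column_map_of /=.
by rewrite /ev -!hom_of_first_column; case: g.
Qed.

End Pairs.

Program Definition DF_dsum X Y : chain_map (DF (dsum X Y)) (dsum (DF X) (DF Y)) :=
  @ChainMap _ (DF (dsum X Y)) (dsum (DF X) (DF Y))
    (fun i => @hom_split (X i) (Y i)) _.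
Next Obligation.
by apply: injective_projections; exact: hom_column_ext.
Qed.

Lemma quasi_iso_DF_dsum X Y : quasi_iso (DF_dsum X Y).
Proof.
by apply: quasi_iso_bij => i; [exact: hom_split_inj | exact: hom_split_surj].
Qed.

Program Definition DF_cone X Y (f : chain_map X Y) :
    chain_map (DF (cone f)) (cone (DF_map f)) :=
  @ChainMap _ (DF (cone f)) (cone (DF_map f))
    (fun i => @hom_split (X (i + 1)) (Y i)) _.
Next Obligation.
by apply: injective_projections; exact: hom_column_ext.
Qed.

Lemma quasi_iso_DF_cone X Y (f : chain_map X Y) : quasi_iso (DF_cone f).
Proof.
by apply: quasi_iso_bij => i; [exact: hom_split_inj | exact: hom_split_surj].
Qed.

End OnMaps.

Lemma der_inv_square (S : pzRingType) (X Y X' Y' : complex S) (s : chain_map X Y)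
    (s' : chain_map X' Y') (qs : quasi_iso s) (qs' : quasi_iso s')
    (u : der_hom X X') (v : der_hom Y Y') :
  der_eq (der_comp u (der_map s')) (der_comp (der_map s) v) ->
  der_eq (der_comp (der_inv qs) u) (der_comp v (der_inv qs')).
Proof.
move=> sq; rewrite -[u]der_eq_idr -(der_eq_invr qs') !der_eq_assoc.
rewrite -(der_eq_assoc _ u) sq !der_eq_assoc der_eq_invl.
by rewrite der_eq_idl.
Qed.

Lemma DF_hom_shift (X Y : complex E) (f : der_hom X Y) :
  der_eq (der_comp (DF_hom (der_shift f)) (der_map (DF_shift Y)))
         (der_comp (der_map (DF_shift X)) (der_shift (DF_hom f))).
Proof.
elim: f => {X Y} [X Y f|X Y s qs|X Y Z f IHf g IHg] /=.
- by rewrite !der_eq_map; apply: der_eq_ext.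
- apply: der_inv_square; rewrite !der_eq_map; exact: der_eq_ext.
- by rewrite -der_eq_assoc IHg der_eq_assoc IHf der_eq_assoc.
Qed.

(** The functor commutes with shifts and cones only up to natural isomorphism of
    complexes, so these isomorphisms enter the transported triangle. *)
Lemma DF_triangle (X Y Z : complex E) (u : der_hom X Y) (v : der_hom Y Z)
    (w : der_hom Z (shift X)) :
  exact_triangle u v w ->
  exact_triangle (DF_hom u) (DF_hom v)
    (der_comp (DF_hom w) (der_map (DF_shift X))).
Proof.
move=> [X' [Y' [f [a [b [c [[ia ib ic] [/DF_hom_eq/= E1 /DF_hom_eq/= E2]]]]]]]].
move=> /DF_hom_eq/= E3.
pose q := @quasi_iso_DF_cone X' Y' f.
have iq : is_der_iso (der_inv q).
  by exists (der_map (DF_cone f)); split; [exact: der_eq_invl|exact: der_eq_invr].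
exists (DF X'), (DF Y'), (DF_map f), (DF_hom a), (DF_hom b).
exists (der_comp (der_inv q) (DF_hom c)); split.
  split; [exact: is_der_iso_DF | exact: is_der_iso_DF |].
  by apply: is_der_iso_comp => //; exact: is_der_iso_DF.
split=> //.
  rewrite -E2 der_eq_assoc; apply: der_eq_comp => //.
  have -> : der_eq (der_map (cone_in (DF_map f)))
      (der_comp (der_map (DF_map (cone_in f))) (der_map (DF_cone f))).
    rewrite der_eq_map; apply: der_eq_ext => i x.
    by apply: injective_projections; exact: hom_column_ext.
  by rewrite -der_eq_assoc der_eq_invr der_eq_idr.
rewrite -der_eq_assoc (der_eq_assoc (DF_hom c)) -E3 -der_eq_assoc DF_hom_shift.
have -> : der_eq (der_comp (der_map (DF_map (cone_out f)))
    (der_comp (der_map (DF_shift X')) (der_shift (DF_hom a))))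
    (der_comp (der_comp (der_map (DF_cone f)) (der_map (cone_out (DF_map f))))
      (der_shift (DF_hom a))).
  rewrite der_eq_assoc; apply: der_eq_comp => //; rewrite !der_eq_map.
  exact: der_eq_ext.
by rewrite -der_eq_assoc der_eq_assoc der_eq_invl der_eq_idl.
Qed.

Section Transport.
Variables (T : complex E -> Prop) (T' : complex (subring A) -> Prop).
Hypothesis TT' : forall X, T X -> T' (DF X).

Lemma add_closure_DF M M' : (forall X, M X -> M' (DF X)) ->
  forall X, add_closure T M X -> add_closure T' M' (DF X).
Proof.
move=> MM' X; elim=> {X}.
- by move=> X TX MX; apply: add_base; [exact: TT' | exact: MM'].
- move=> X TX X0; apply: add_zero; first exact: TT'.
  exact: der_iso_trans (der_iso_DF X0) DF_zero.
- move=> X Y Z TZ _ aX _ aY ZXY; apply: add_dsum aX aY _; first exact: TT'.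
  by apply: der_iso_trans (der_iso_DF ZXY) (der_iso_map (@quasi_iso_DF_dsum X Y)).
- move=> X X' Z TX TX' _ aZ ZXX'.
  apply: (add_summand (TT' TX) (TT' TX') aZ).
  by apply: der_iso_trans (der_iso_DF ZXX') (der_iso_map (@quasi_iso_DF_dsum X X')).
- move=> X Y TY _ aX YX; apply: add_shift aX _; first exact: TT'.
  by apply: der_iso_trans (der_iso_DF YX) (der_iso_map (@quasi_iso_DF_shift X)).
- move=> X Y TY _ aX YX; apply: add_unshift aX _; first exact: TT'.
  apply: der_iso_trans (der_iso_DF YX); apply: der_iso_sym.
  exact: (der_iso_map (@quasi_iso_DF_shift Y)).
Qed.

Lemma gen_succ_DF M M' : (forall X, M X -> M' (DF X)) ->
  forall k X, gen_succ T M k X -> gen_succ T' M' k (DF X).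
Proof.
move=> MM'; elim=> [|k IHk] /=; first exact: add_closure_DF.
apply: add_closure_DF => X [TX [Y [Z [u [v [w [MY MZ tri]]]]]]].
split; first exact: TT'.
exists (DF Y), (DF Z), (DF_hom u), (DF_hom v).
exists (der_comp (DF_hom w) (der_map (DF_shift Y))); split.
- by apply: add_closure_DF MY.
- exact: IHk.
- exact: DF_triangle.
Qed.

End Transport.
End ColumnFunctor.

(** * Complexes of submodules *)

Section SubmoduleTypes.
Variable S : pzRingType.

Definition submod_pred (V : lmodType S) (K : V -> Prop) : {pred V} :=
  fun x => `[< K x >].

Lemma submod_predP (V : lmodType S) (K : V -> Prop) x :
  reflect (K x) (x \in submod_pred K).
Proof. exact: asboolP. Qed.

Record submod (V : lmodType S) (K : V -> Prop) (hK : submodule K) : Type :=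
  Submod { submod_val : V; _ : submod_val \in submod_pred K }.

Section Instances.
Variables (V : lmodType S) (K : V -> Prop) (hK : submodule K).

HB.instance Definition _ := [isSub for @submod_val V K hK].
HB.instance Definition _ := [Choice of submod hK by <:].

Fact submod_closedP : submod_closed (submod_pred K).
Proof.
have [K0 KL] := hK; split=> [|a u v /submod_predP Ku /submod_predP Kv].
  exact/submod_predP.
by apply/submod_predP; exact: KL.
Qed.

HB.instance Definition _ :=
  GRing.SubChoice_isSubLmodule.Build _ _ _ (submod hK) submod_closedP.

Lemma submodP (x : submod hK) : K (val x).
Proof. exact/submod_predP/valP. Qed.

Lemma submod_val_lin a (x y : submod hK) : val (a *: x + y) = a *: val x + val y.
Proof. by []. Qed.

Definition to_submod (u : V) (Ku : K u) : submod hK :=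
  Submod hK (introT (submod_predP _ _) Ku).

Variables (M : lmodType S) (f : M -> V).

Definition corestrict of linear f & (forall x, K (f x)) : M -> submod hK :=
  fun x => insubd 0 (f x).

Lemma val_corestrict flin fK x : val (@corestrict flin fK x) = f x.
Proof. by rewrite insubdK //; apply/submod_predP. Qed.

Fact corestrict_linear flin fK : linear (@corestrict flin fK).
Proof.
by move=> a x y; apply: val_inj; rewrite linearP /= !val_corestrict flin.
Qed.

HB.instance Definition _ flin fK := GRing.isLinear.Build S M (submod hK) *:%R
  (@corestrict flin fK) (@corestrict_linear flin fK).

End Instances.

Lemma submod_fgp (V : lmodType S) (K : V -> Prop) (hK : submodule K) :
  fgp_on K -> fin_gen (submod hK) /\ projective (submod hK).
Proof.
move=> [n [v [phi [Kv phiK db]]]].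
pose w (a : 'I_n) := to_submod hK (Kv a (ltn_ord a)).
have dbw (x : submod hK) : x = \sum_(a < n) phi a (val x) *: w a.
  apply: val_inj; rewrite [LHS](db _ (submodP x)) raddf_sum.
  by apply: eq_bigr.
split; first by exists n, w => x; exists (fun a : 'I_n => phi a (val x)); exact: dbw.
move=> M N g f gsurj; have /choice[y yP] : forall a, exists y, g y = f (w a).
  by move=> a; exact: gsurj.
pose h (x : submod hK) := \sum_(a < n) phi a (val x) *: y a.
have hlin : linear h.
  move=> a x x'; rewrite /h scaler_sumr -big_split; apply: eq_bigr => b _ /=.
  rewrite phiK; [|exact: submodP|exact: submodP].
  by rewrite scalerDl scalerA.
pose hL := GRing.isLinear.Build S (submod hK) M *:%R h hlin.
exists (HB.pack h hL : {linear submod hK -> M}) => x.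
rewrite /= [in RHS](dbw x) linear_sum /h linear_sum; apply: eq_bigr => a _.
by rewrite !linearZ /= yP.
Qed.

Lemma fgp_on_projective (M : lmodType S) :
  fin_gen M -> projective M -> fgp_on (fun _ : M => True).
Proof.
move=> [n [v gv]] pM; pose ext (a : nat) := if insub a is Some i then v i else 0.
have [|h hP] := pM (nat -> S^o : lmodType S) M (combination n ext) idfun.
  move=> y; have [c ->] := gv y.
  exists (fun a => if insub a is Some i then c i else 0).
  by apply: eq_bigr => a _; rewrite /ext valK.
exists n, ext, (fun a x => h x a); split=> // [a b x y _ _|x _].
  by rewrite linearP.
by rewrite -[LHS](hP x).
Qed.

Lemma linear_zero (V W : lmodType S) (f : V -> W) : linear f -> f 0 = 0.
Proof. by move=> fL; have := fL (-1) 0 0; rewrite !scaleN1r !addNr. Qed.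

(** A complex of submodules of one fixed module; the maps need only be defined
    and linear where they are used. *)
Record subcomplex (V : lmodType S) : Type := Subcomplex {
  sc_ob : int -> V -> Prop;
  sc_d : int -> V -> V;
  sc_sub : forall i, submodule (sc_ob i);
  sc_lin : forall i, lin_on (sc_ob i) (sc_d i);
  sc_in : forall i u, sc_ob i u -> sc_ob (i + 1) (sc_d i u);
  sc_dd : forall i u, sc_ob i u -> sc_d (i + 1) (sc_d i u) = 0 }.

Section ComplexOf.
Variables (V : lmodType S) (Y : subcomplex V).
Notation ob i := (submod (sc_sub Y i)).

Fact sc_d_linear i : linear (fun x : ob i => sc_d Y i (val x)).
Proof. by move=> a u v; rewrite linearP /= (@sc_lin _ Y i) //; exact: submodP. Qed.

Fact sc_d_in i (x : ob i) : sc_ob Y (i + 1) (sc_d Y i (val x)).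
Proof. by apply: sc_in; exact: submodP. Qed.

Program Definition complex_of : complex S := @Complex S (fun i => ob i)
  (fun i => corestrict (sc_sub Y (i + 1)) (@sc_d_linear i) (@sc_d_in i)) _.
Next Obligation.
apply: val_inj; rewrite /= !val_corestrict; apply: sc_dd; exact: submodP.
Qed.

Lemma val_complex_of_d i (x : complex_of i) :
  val (cx_d complex_of i x) = sc_d Y i (val x).
Proof. exact: val_corestrict. Qed.

Lemma complex_of_cocycle i (x : complex_of i) :
  cx_d complex_of i x = 0 <-> sc_d Y i (val x) = 0.
Proof.
by split=> [/(congr1 val)|E]; [|apply: val_inj]; rewrite val_complex_of_d.
Qed.

Variables (Q : complex S) (f : forall i, Q i -> V).
Hypotheses (flin : forall i, linear (@f i))
  (fin : forall i (x : Q i), sc_ob Y i (f x))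
  (fcomm : forall i (x : Q i), f (cx_d Q i x) = sc_d Y i (f x)).

Program Definition cm_into : chain_map Q complex_of :=
  @ChainMap S Q complex_of (fun i => corestrict (sc_sub Y i) (flin (i := i)) (@fin i)) _.
Next Obligation.
by apply: val_inj; rewrite /= !val_corestrict fcomm.
Qed.

Lemma quasi_iso_into :
    (forall i (x : Q (i + 1)), cx_d Q (i + 1) x = 0 ->
      (exists2 u, sc_ob Y i u & f x = sc_d Y i u) -> exists x', x = cx_d Q i x') ->
    (forall i u, sc_ob Y (i + 1) u -> sc_d Y (i + 1) u = 0 ->
      exists x : Q (i + 1), cx_d Q (i + 1) x = 0 /\
        exists2 u', sc_ob Y i u' & u = f x + sc_d Y i u') ->
  quasi_iso cm_into.
Proof.
move=> finj fsurj i; split=> [x dx [y /(congr1 val)]|y].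
  rewrite val_complex_of_d val_corestrict => E; apply: finj => //.
  by exists (val y) => //; exact: submodP.
move=> /complex_of_cocycle dy.
have [x [dx [u Yu E]]] := fsurj i _ (submodP y) dy; exists x; split=> //.
exists (to_submod (sc_sub Y i) Yu); apply: val_inj.
by rewrite E raddfD /= val_complex_of_d val_corestrict.
Qed.

End ComplexOf.
End SubmoduleTypes.

(** * Modules over the envelope *)

(** An alias of the product, on which the envelope acts by matrices. *)
Definition col2 (H : pzRingType) (A : subringClosed H) (U : lmodType H) : Type :=
  (U * U)%type.

Section ColumnModules.
Variables (H : pzRingType) (A : subringClosed H) (U : lmodType H).
Notation E := (envelope A).

HB.instance Definition _ := GRing.Zmodule.copy (col2 A U) (U * U)%type.

Definition col2_scale (M : E) (p : col2 A U) : col2 A U :=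
  (val M ord0 ord0 *: p.1 + val M ord0 ord_max *: p.2,
   val M ord_max ord0 *: p.1 + val M ord_max ord_max *: p.2).

Fact col2_scaleA a b p : col2_scale a (col2_scale b p) = col2_scale (a * b) p.
Proof.
rewrite /col2_scale /= !mxE !sum_ord2.
by congr (_, _); rewrite !scalerDr !scalerDl !scalerA addrACA.
Qed.
Fact col2_scale1 : left_id 1 col2_scale.
Proof.
by move=> p; rewrite /col2_scale /= !mxE /= !scale1r !scale0r addr0 add0r; case: p.
Qed.
Fact col2_scaleDr : right_distributive col2_scale +%R.
Proof.
by move=> a p q; rewrite /col2_scale /= !scalerDr; congr (_, _); rewrite addrACA.
Qed.
Fact col2_scaleDl p : {morph col2_scale^~ p : a b / a + b}.
Proof.
by move=> a b; rewrite /col2_scale /= !mxE !scalerDl; congr (_, _); rewrite addrACA.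
Qed.

HB.instance Definition _ := GRing.Zmodule_isLmodule.Build E (col2 A U)
  col2_scaleA col2_scale1 col2_scaleDr col2_scaleDl.

Lemma col2_scaleE (M : E) (p : col2 A U) : M *: p =
  (val M ord0 ord0 *: p.1 + val M ord0 ord_max *: p.2,
   val M ord_max ord0 *: p.1 + val M ord_max ord_max *: p.2).
Proof. by []. Qed.

(** [(K; K')] is a module over the envelope when [K'] is an [H]-submodule of [K]
    which contains the multiples of [K] by the conductor. *)
Definition lattice_pair (K K' : U -> Prop) : Prop :=
  [/\ submodule (K : restr A U -> Prop), submodule K',
      forall c u, c \in conductor A -> K u -> K' (c *: u) &
      forall u, K' u -> K u].

Definition pair_pred (K K' : U -> Prop) (p : col2 A U) : Prop := K p.1 /\ K' p.2.

Lemma pair_submodule K K' : lattice_pair K K' -> submodule (pair_pred K K').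
Proof.
move=> [hK hK' CK K'K]; split; first by split; [case: hK | case: hK'].
move=> M p q [Kp1 Kp2] [Kq1 Kq2]; case: M => M MP; case/andP: (MP) => M00 M10.
have KD u v : K u -> K v -> K (u + v) := @submoduleD _ _ _ hK u v.
split=> /=.
  apply: (KD _ _) => //; apply: (KD _ _); first exact: (submoduleZ hK (Subring M00)).
  by apply: K'K; exact: submoduleZ.
apply: (submoduleD hK') => //; apply: (submoduleD hK'); first exact: CK.
exact: submoduleZ.
Qed.

Lemma col2_sum (I : Type) (r : seq I) (F : I -> col2 A U) :
  \sum_(i <- r) F i = (\sum_(i <- r) (F i).1, \sum_(i <- r) (F i).2).
Proof.
elim: r => [|i r IHr]; first by rewrite !big_nil.
by rewrite !big_cons IHr.
Qed.

End ColumnModules.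

Section ColumnProjectives.
Variables (H : pzRingType) (A : subringClosed H).
Notation E := (envelope A).
Notation U := (nat -> H^o).

Definition column_mx (j : 'I_2) (x y : H) : 'M[H]_2 :=
  \matrix_(i, k) (if k == j then (if i == ord0 then x else y) else 0).

Definition env_column (j : 'I_2) (x y : H) : E := insubd (0 : E) (column_mx j x y).

Lemma val_env_column j x y : column_mx j x y \in envelope_shape A ->
  val (env_column j x y) = column_mx j x y.
Proof. by move=> xyE; rewrite insubdK. Qed.

Lemma column0_shape x y : x \in A -> y \in conductor A ->
  column_mx ord0 x y \in envelope_shape A.
Proof. by move=> xA yC; rewrite inE /= !mxE /= xA. Qed.

Lemma column1_shape x y : column_mx ord_max x y \in envelope_shape A.
Proof. by rewrite inE /= !mxE /= rpred0 conductor0. Qed.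

Lemma env_column_lin j (M : E) x y x' y' :
    column_mx j x y \in envelope_shape A -> column_mx j x' y' \in envelope_shape A ->
  env_column j (val M ord0 ord0 * x + val M ord0 ord_max * y + x')
               (val M ord_max ord0 * x + val M ord_max ord_max * y + y') =
  M * env_column j x y + env_column j x' y'.
Proof.
move=> h h'; apply: val_inj.
have E1 : column_mx j (val M ord0 ord0 * x + val M ord0 ord_max * y + x')
               (val M ord_max ord0 * x + val M ord_max ord_max * y + y') =
    val M *m column_mx j x y + column_mx j x' y'.
  apply/matrixP => i k; rewrite !mxE sum_ord2 !mxE.
  case: (k == j); last by rewrite !mulr0 !addr0.
  case: eqP => [->//|]; case: (i =P ord_max) => [->//|].
  by case: i => [[|[|//]] lt_i] /eqP + /eqP; rewrite -!val_eqE.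
have E2 : val (M * env_column j x y + env_column j x' y') =
    val M *m column_mx j x y + column_mx j x' y'.
  by rewrite /= !val_env_column.
by rewrite E2 val_env_column E1 // -E2; exact: valP.
Qed.

(** Modules of the form [(K; C K)], for projective [K], are sums of summands of
    the first column of the envelope. *)
Lemma pair_fgp_first (K K' : U -> Prop) n (w : nat -> U) :
    (forall a, (a < n)%N -> K (w a)) -> K' 0 ->
    (forall u, K u -> (forall a, (u a : H) \in A) /\ u = combination n w u) ->
    (forall u, K' u ->
      (forall a, (u a : H) \in conductor A) /\ u = combination n w u) ->
  fgp_on (@pair_pred H A U K K').
Proof.
move=> Kw K'0 KA K'C; exists n, (fun a => (w a, 0)).
exists (fun a p => env_column ord0 (p.1 a) (p.2 a)).
have shape p a : pair_pred K K' p ->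
    column_mx ord0 (p.1 a) (p.2 a) \in envelope_shape A.
  by move=> [/KA[pA _] /K'C[pC _]]; exact: column0_shape.
split=> [a lt_an|a M p q Kp Kq|p Kp]; first by split=> //; exact: Kw.
  by apply: env_column_lin; exact: shape.
have [[_ p1] [_ p2]] := (KA _ Kp.1, K'C _ Kp.2).
rewrite col2_sum [LHS]surjective_pairing; congr (_, _).
  rewrite [LHS]p1; apply: eq_bigr => a _.
  by rewrite col2_scaleE val_env_column ?shape //= !mxE /= scaler0 addr0.
rewrite [LHS]p2; apply: eq_bigr => a _.
by rewrite col2_scaleE val_env_column ?shape //= !mxE /= scaler0 addr0.
Qed.

(** The second column of the envelope is [(H; H)]. *)
Lemma pair_fgp_second n :
  fgp_on (@pair_pred H A U (corner (fun=> 1) n) (corner (fun=> 1) n)).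
Proof.
pose b := corner_basis (fun=> 1 : H).
exists n, (fun a => (0, b a)), (fun a p => env_column ord_max (p.1 a) (p.2 a)).
split=> [a lt_an|a M p q _ _|p [p1 p2]].
- split; first by case: (@corner_submodule H (fun=> 1) n).
  by apply: corner_basis_in => // c; rewrite mulr1.
- by apply: env_column_lin; exact: column1_shape.
rewrite col2_sum [LHS]surjective_pairing; congr (_, _).
  rewrite [LHS](corner_sum p1); apply: eq_bigr => a _.
  by rewrite col2_scaleE val_env_column ?column1_shape //= !mxE /= scaler0 add0r.
rewrite [LHS](corner_sum p2); apply: eq_bigr => a _.
by rewrite col2_scaleE val_env_column ?column1_shape //= !mxE /= scaler0 add0r.
Qed.

End ColumnProjectives.

(** * Complexes over the envelope *)

Section PairComplex.
Variables (H : pzRingType) (A : subringClosed H) (U : lmodType H).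
Variables (K K' : int -> U -> Prop) (d : int -> {linear U -> U}).
Hypotheses (hKK' : forall i, lattice_pair A (K i) (K' i))
  (dK : forall i u, K i u -> K (i + 1) (d i u))
  (dK' : forall i u, K' i u -> K' (i + 1) (d i u))
  (dd : forall i u, K i u -> d (i + 1) (d i u) = 0).

Definition pair_d (i : int) (p : col2 A U) : col2 A U := (d i p.1, d i p.2).

Fact pair_d_lin i : lin_on (pair_pred (K i) (K' i)) (pair_d i).
Proof.
by move=> M p q _ _; rewrite /pair_d col2_scaleE /= !linearD !linearZ.
Qed.

Fact pair_d_in i p :
  pair_pred (K i) (K' i) p -> pair_pred (K (i + 1)) (K' (i + 1)) (pair_d i p).
Proof. by move=> [Kp K'p]; split; [exact: dK | exact: dK']. Qed.

Fact pair_dd i p : pair_pred (K i) (K' i) p -> pair_d (i + 1) (pair_d i p) = 0.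
Proof.
move=> [Kp K'p]; have [_ _ _ K'K] := hKK' i.
by rewrite /pair_d /= !dd //; exact: K'K.
Qed.

Definition pair_subcomplex : subcomplex (col2 A U) :=
  Subcomplex (fun i => pair_submodule (hKK' i)) pair_d_lin pair_d_in pair_dd.

Fact first_d_lin i : @lin_on (subring A) (restr A U) (restr A U) (K i) (d i).
Proof. exact/lin_on_restr/lin_on_linear. Qed.

Fact first_sub i : @submodule (subring A) (restr A U) (K i).
Proof. by case: (hKK' i). Qed.

Definition first_subcomplex : subcomplex (restr A U) :=
  Subcomplex first_sub first_d_lin dK dd.

Notation X := (complex_of pair_subcomplex).

Definition first_component (i : int) (f : hom_column (X i)) : restr A U :=
  (val ((f : {linear column A -> X i}) (first_column A))).1.

Lemma hom_first_column i (f : hom_column (X i)) (p : column A) :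
  val ((f : {linear column A -> X i}) p) =
  pad p *: val ((f : {linear column A -> X i}) (first_column A)).
Proof. by rewrite -{1}[p]pad_first_column linearZ. Qed.

Fact first_component_linear i : linear (@first_component i).
Proof.
move=> a f g; rewrite /first_component.
have -> : ((a *: f + g : hom_column (X i)) : {linear column A -> X i})
    (first_column A) = (f : {linear column A -> X i})
    (column_rmul a (first_column A)) + (g : {linear column A -> X i})
    (first_column A) by [].
rewrite raddfD /= hom_first_column; congr (_ + _).
by rewrite col2_scaleE /= !mxE /= mul1r scale0r addr0.
Qed.

Fact first_component_in i (f : hom_column (X i)) : K i (first_component f).
Proof. by have [] := submodP ((f : {linear column A -> X i}) (first_column A)). Qed.

Fact first_component_d i (f : DF X i) :
  first_component (cx_d (DF X) i f) = d i (first_component f).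
Proof. by rewrite /first_component /= val_corestrict. Qed.

(** The functor keeps the first components of the columns, because it is
    multiplication by the first matrix unit. *)
Lemma der_iso_first_component : der_iso (DF X) (complex_of first_subcomplex).
Proof.
pose c := @cm_into _ _ first_subcomplex (DF X) first_component
  first_component_linear first_component_in first_component_d.
apply: (@der_iso_map _ _ _ c); apply: quasi_iso_bij => i.
  move=> f /(congr1 val); rewrite /= val_corestrict => f0.
  rewrite [f]hom_of_first_column; set v := _ (first_column A).
  have -> : v = 0.
    apply: val_inj; rewrite /v hom_first_column col2_scaleE /= !mxE /=.
    rewrite -/(first_component f) f0.
    by rewrite !scaler0 !scale0r !addr0.
  by apply: hom_column_ext => p; exact: scaler0.
move=> y; have K'0 : K' i 0 by have [_ []] := hKK' i.
pose x := to_submod (sc_sub pair_subcomplex i) (u := (val y, 0))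
  (conj (submodP y) K'0).
exists (hom_of x : hom_column (X i)); apply: val_inj.
rewrite /= val_corestrict /first_component.
have -> : val ((hom_of x : {linear column A -> X i}) (first_column A)) =
  pad (first_column A) *: ((val y, 0) : col2 A U) by [].
by rewrite col2_scaleE /= !mxE /= scale1r scaler0 addr0.
Qed.

End PairComplex.

(** * Lifting objects to the derived category of the envelope *)

Section Lattices.
Variables (H : pzRingType) (A : subringClosed H).
Notation U := (nat -> H^o).
Notation C := (conductor A).

(** For the rows [w] of an idempotent matrix with entries in [A], these are the
    vectors with entries in [R] in the row space: a projective [A]-module for
    [R = A], and its multiple by the conductor for [R = C]. *)
Definition lattice (R : {pred H}) (n : nat) (w : nat -> U) (u : U) : Prop :=
  (forall a, (u a : H) \in R) /\ u = combination n w u.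

Lemma combinationE n (y : nat -> U) (u : U) b :
  combination n y u b = \sum_(a < n) (u a : H) * (y a b : H).
Proof. by rewrite /combination fct_sumE. Qed.

Lemma combination_assoc (V : lmodType H) n n' (y : nat -> V) (z : nat -> U) u :
  combination n' y (combination n z u) =
  combination n (fun a => combination n' y (z a)) u.
Proof.
rewrite [X in combination n' y X]/combination linear_sum.
by apply: eq_bigr => a _; rewrite linearZ.
Qed.

Lemma conductor_sum (I : Type) (r : seq I) (F : I -> H) :
  (forall i, F i \in C) -> \sum_(i <- r) F i \in C.
Proof.
move=> FC; apply: (big_ind (fun x => x \in C)) => //; first exact: conductor0.
by move=> x y; exact: conductorD.
Qed.

Lemma conductor_sub x : x \in C -> x \in A.
Proof. by move=> /conductorP[]. Qed.

Section OneLattice.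
Variables (n : nat) (w : nat -> U).

Lemma lattice_conductor u : lattice C n w u -> lattice A n w u.
Proof. by move=> [uC uE]; split=> // a; exact: conductor_sub. Qed.

Lemma lattice_pairP : lattice_pair A (lattice A n w) (lattice C n w).
Proof.
split=> [||c u cC [uA uE]|u]; last exact: lattice_conductor.
- split=> [|a u u' [uA uE] [u'A u'E]].
    by split=> [a|]; [exact: rpred0 | rewrite linear0].
  split=> [b|]; first by apply: rpredD => //; apply: rpredM => //; exact: valP.
  by rewrite restr_scaleE linearP /= -uE -u'E.
- split=> [|h u u' [uC uE] [u'C u'E]].
    by split=> [a|]; [exact: conductor0 | rewrite linear0].
  split=> [b|]; last by rewrite linearP /= -uE -u'E.
  by apply: conductorD => //; exact: conductorMl.
- by split=> [a|]; [exact: conductorMr | rewrite linearZ /= -uE].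
Qed.

Lemma lattice_fgp : (forall a, (a < n)%N -> lattice A n w (w a)) ->
  fgp_on (@pair_pred H A U (lattice A n w) (lattice C n w)).
Proof.
move=> hw; apply: (@pair_fgp_first _ _ _ _ n w) => //.
by split=> [a|]; [exact: conductor0 | rewrite linear0].
Qed.

Variables (n' : nat) (w' y : nat -> U).
Hypothesis hy : forall a, (a < n)%N -> lattice A n' w' (y a).

Lemma lattice_map R u : R = (A : {pred H}) \/ R = C -> lattice R n w u ->
  lattice R n' w' (combination n y u).
Proof.
move=> hR [uR _]; split=> [b|]; last first.
  rewrite combination_assoc; apply: eq_bigr => a _; congr (_ *: _).
  exact: (hy (ltn_ord a)).2.
rewrite combinationE; case: hR => ER; rewrite ER in uR *.
  apply: rpred_sum => a _; apply: rpredM => //; exact: (hy (ltn_ord a)).1.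
apply: conductor_sum => a; apply: conductorMr => //.
exact: (hy (ltn_ord a)).1.
Qed.

End OneLattice.

Lemma corner_lattice (e : nat -> H) n u : (forall a, e a * e a = e a) ->
  u = combination n (corner_basis e) u <-> corner e n u.
Proof.
move=> ee; split=> [->|]; last exact: corner_sum.
have hc := @corner_submodule H e n; apply: submodule_sum => // a _.
by apply: submoduleZ => //; exact: corner_basis_in.
Qed.

End Lattices.

Section Coordinates.
Variables (H : pzRingType) (A : subringClosed H) (P : complex (subring A)).
Variables (n : int -> nat) (v : forall i, nat -> P i)
  (phi : forall i, nat -> P i -> subring A).
Hypothesis db : forall i, dual_basis (fun _ : P i => True) (n i) (@v i) (@phi i).
Notation U := (nat -> H^o).

(** Coordinates in the dual bases embed all the terms of [P] into one module. *)
Definition coord (i : int) (x : P i) : U :=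
  fun b => if (b < n i)%N then val (phi b x) else 0.

Definition uncoord (i : int) (u : U) : P i :=
  \sum_(b < n i) to_subring A (u b) *: v i b.

Lemma coord_in i (x : P i) b : coord x b \in A.
Proof. by rewrite /coord; case: ifP => _; [exact: valP | exact: rpred0]. Qed.

Lemma coord_linear i : linear (@coord i : P i -> restr A U).
Proof.
move=> a x y; apply/funext => b.
rewrite -[RHS]/(val a * (coord x b : H) + coord y b) /coord.
have [_ phiL _] := db i; case: ifP => _; last by rewrite mulr0 addr0.
by rewrite phiL.
Qed.

Lemma coordP i (a : subring A) (x y : P i) :
  coord (a *: x + y) = val a *: coord x + coord y.
Proof. exact: coord_linear. Qed.

Lemma coord0 i : coord (0 : P i) = 0.
Proof.
have := coordP 0 (0 : P i) 0; rewrite scaler0 addr0 scale0r add0r.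
have := coordP 1 (0 : P i) 0; rewrite scaler0 addr0 scale1r => E _.
by apply: (addrI (coord (0 : P i))); rewrite addr0.
Qed.

Lemma coord_sum i k (c : nat -> subring A) (y : nat -> P i) :
  coord (\sum_(a < k) c a *: y a) = \sum_(a < k) val (c a) *: coord (y a).
Proof.
elim: k => [|k IHk]; first by rewrite !big_ord0 coord0.
by rewrite !big_ord_recr /= addrC coordP IHk addrC.
Qed.

Lemma coordK i (x : P i) : uncoord i (coord x) = x.
Proof.
have [_ _ dbi] := db i; rewrite [RHS]dbi //; apply: eq_bigr => b _.
rewrite /coord ltn_ord; congr (_ *: _); apply: val_inj.
by rewrite to_subringK //; exact: valP.
Qed.

Lemma combination_coord i (V : lmodType H) (y : nat -> V) (x : P i) :
  combination (n i) y (coord x) = \sum_(a < n i) val (phi a x) *: y a.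
Proof. by apply: eq_bigr => a _; rewrite /coord ltn_ord. Qed.

Definition coord_basis (i : int) (a : nat) : U := coord (v i a).

Lemma lattice_coord i (x : P i) : lattice A (n i) (coord_basis i) (coord x).
Proof.
split=> [a|]; first exact: coord_in.
have [_ _ dbi] := db i; rewrite combination_coord [in LHS](dbi x) //.
exact: (coord_sum (n i) (fun a => phi a x)).
Qed.

Lemma coord_lattice i u : lattice A (n i) (coord_basis i) u ->
  u = coord (uncoord i u).
Proof.
move=> [uA uE]; rewrite [LHS]uE (coord_sum _ (fun b => to_subring A (u b))).
by apply: eq_bigr => a _; rewrite to_subringK.
Qed.

(** The differential of [P] in coordinates, as a map of [H]-modules. *)
Definition coord_d (i : int) : {linear U -> U} :=
  combination (n i) (fun a => coord (cx_d P i (v i a))).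

Lemma coord_dE i (x : P i) : coord_d i (coord x) = coord (cx_d P i x).
Proof.
have [_ _ dbi] := db i; rewrite /coord_d /= combination_coord.
rewrite [in RHS](dbi x) // linear_sum /=.
rewrite -(coord_sum (n i) (fun a => phi a x) (fun a => cx_d P i (v i a))).
by congr (coord _); apply: eq_bigr => a _; rewrite linearZ.
Qed.

Definition coord_cocycle (i : int) (u : U) : Prop :=
  exists2 z : P i, cocycle z & u = coord z.

Lemma coord_cocycle_submodule i : @submodule (subring A) (restr A U) (coord_cocycle i).
Proof.
have [c0 cL] := @cocycle_submodule _ P i.
split=> [|a u u' [z dz ->] [z' dz' ->]]; first by exists 0; rewrite ?coord0.
by exists (a *: z + z'); [exact: cL | rewrite coordP].
Qed.

Lemma coord_cocycle_retract i :
  stable_retract (coord_cocycle i : restr A U -> Prop) (@cocycle _ P i).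
Proof.
exists (uncoord i), (@coord i), void, (@of_void _), (@of_void _).
split=> [|||u [z _ ->]]; last by rewrite coordK big_pred0 ?addr0 // => -[].
- split=> [a u u' [z dz ->] [z' dz' ->]|u [z dz ->]]; last by rewrite coordK.
  by rewrite restr_scaleE -coordP !coordK.
- split=> [a x y _ _|x dx]; first exact: coordP.
  by exists x.
- by split=> -[].
Qed.

End Coordinates.

Section Realization.
Variables (H : pzRingType) (A : subringClosed H).
Hypothesis hHA : backstrom_pair A.
Variable P : complex (subring A).
Variables (n : int -> nat) (v : forall i, nat -> P i)
  (phi : forall i, nat -> P i -> subring A).
Hypothesis db : forall i, dual_basis (fun _ : P i => True) (n i) (@v i) (@phi i).
Variable j : int.
Hypothesis exactP : forall i : int, (i <= j)%R -> exact_at P i.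
Notation U := (nat -> H^o).
Notation E := (envelope A).
Notation coord := (coord n phi).
Notation coord_cocycle := (coord_cocycle n phi).
Notation coord_basis := (coord_basis n v phi).
Notation coord_d := (coord_d n v phi).

(* A minimal cover of the image of the differential in degree [j]. *)
Variables (q : nat) (e : nat -> H) (m : nat -> U).
Hypotheses (eA : forall a, e a \in A) (ee : forall a, e a * e a = e a)
  (em : forall a, e a *: m a = m a)
  (mN : forall a, (a < q)%N -> @coord_cocycle (j + 1) (m a))
  (kerJ : forall u, corner e q u -> (forall a, (u a : H) \in A) ->
    combination q m u = 0 -> minimal_kernel e q m u)
  (gm : forall w, @coord_cocycle (j + 1) w -> exists2 c : U,
    forall a, (c a : H) \in A & w = combination q m c).

(* A free resolution over [H] of the kernel of this cover. *)
Variables (r : nat -> nat) (x : nat -> nat -> U).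
Hypotheses (gen0 : generates_on (minimal_kernel e q m) (r 0) (x 0))
  (genS : forall t, generates_on (syzygy (r t) (x t)) (r t.+1) (x t.+1)).

(** Only meaningful for [i < j]. *)
Definition depth (i : int) : nat := absz (j - 1 - i)%R.

Lemma depthS i : (i + 1 < j)%R -> depth i = (depth (i + 1)).+1.
Proof. rewrite /depth; lia. Qed.

Lemma depth0 i : (i + 1 = j)%R -> depth i = 0%N.
Proof. rewrite /depth; lia. Qed.

(** The terms of the lift: [R := A] gives the first row of the columns and
    [R := conductor A] the second. *)
Definition lift_ob (R : {pred H}) (i : int) : U -> Prop :=
  if (i < j)%R then corner (fun=> 1) (r (depth i))
  else if i == j then lattice R q (corner_basis e)
  else lattice R (n i) (coord_basis i).

Definition lift_d (i : int) : {linear U -> U} :=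
  if (i < j)%R then combination (r (depth i)) (x (depth i)) : {linear U -> U}
  else if i == j then combination q m : {linear U -> U}
  else coord_d i.

Lemma lift_ob_lt R i : (i < j)%R -> lift_ob R i = corner (fun=> 1) (r (depth i)).
Proof. by rewrite /lift_ob => ->. Qed.

Lemma lift_ob_eq R : lift_ob R j = lattice R q (corner_basis e).
Proof. by rewrite /lift_ob eqxx; case: ifP => //; lia. Qed.

Lemma lift_ob_gt R i : (j < i)%R -> lift_ob R i = lattice R (n i) (coord_basis i).
Proof. by rewrite /lift_ob => ?; rewrite !ifN //; lia. Qed.

Lemma lift_d_lt i u : (i < j)%R ->
  lift_d i u = combination (r (depth i)) (x (depth i)) u.
Proof. by rewrite /lift_d => ->. Qed.

Lemma lift_d_eq u : lift_d j u = combination q m u.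
Proof. by rewrite /lift_d eqxx; case: ifP => //; lia. Qed.

Lemma lift_d_gt i u : (j < i)%R -> lift_d i u = coord_d i u.
Proof. by rewrite /lift_d => ?; rewrite !ifN //; lia. Qed.

Variant position (i : int) : Prop :=
| Far of (i + 1 < j)%R
| Next of (i + 1 = j)%R
| Here of i = j
| Above of (j < i)%R.

Lemma positionP i : position i.
Proof.
have [lt_ij|lt_ji|->] := Order.TotalTheory.ltgtP i j.
- by case: (eqVneq (i + 1) j) => [|ne]; [exact: Next | apply: Far; lia].
- exact: Above.
- exact: Here.
Qed.

Lemma free_lattice_pair k :
  lattice_pair A (corner (fun=> 1 : H) k) (corner (fun=> 1 : H) k).
Proof.
have hc := @corner_submodule H (fun=> 1) k; split=> //.
  exact: submodule_restr.
by move=> c u _; exact: submoduleZ.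
Qed.

Lemma lift_pair i : lattice_pair A (lift_ob A i) (lift_ob (conductor A) i).
Proof.
have [lt_ij|lt_ji|->] := Order.TotalTheory.ltgtP i j.
- by rewrite !lift_ob_lt //; exact: free_lattice_pair.
- by rewrite !lift_ob_gt //; exact: lattice_pairP.
- by rewrite !lift_ob_eq; exact: lattice_pairP.
Qed.

Lemma resolution_in_kernel i u : (i + 1 = j)%R -> minimal_kernel e q m (lift_d i u).
Proof.
move=> ij; rewrite lift_d_lt; last lia.
rewrite (depth0 ij); apply: combination_in; last by case: gen0.
exact: minimal_kernel_submodule.
Qed.

Lemma resolution_in_syzygy i u : (i + 1 < j)%R ->
  syzygy (r (depth (i + 1))) (x (depth (i + 1))) (lift_d i u).
Proof.
move=> ij; rewrite lift_d_lt; last lia.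
rewrite (depthS ij); apply: combination_in; last by case: (genS (depth (i + 1))).
apply: submodule_ker; first exact: corner_submodule.
exact: lin_on_linear.
Qed.

Lemma minimal_kernel_lattice R u : R = (A : {pred H}) \/ R = conductor A ->
  minimal_kernel e q m u -> lattice R q (corner_basis e) u.
Proof.
move=> hR [cu Ju _]; split; last exact: corner_sum.
move=> a; have uC := jacobson_conductor hHA (Ju a).
by case: hR => -> //; exact: conductor_sub.
Qed.

Lemma lift_d_in R i u : R = (A : {pred H}) \/ R = conductor A ->
  lift_ob R i u -> lift_ob R (i + 1) (lift_d i u).
Proof.
move=> hR; case: (positionP i) => [lt_ij|eq_ij|->|lt_ji].
- by move=> _; rewrite lift_ob_lt //; case: (resolution_in_syzygy u lt_ij).
- move=> _; have := resolution_in_kernel u eq_ij; rewrite eq_ij lift_ob_eq.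
  exact: minimal_kernel_lattice.
- rewrite lift_ob_eq lift_d_eq lift_ob_gt; last lia.
  by apply: (@lattice_map H A) => // a /mN[z _ ->]; exact: lattice_coord.
- rewrite lift_d_gt // !lift_ob_gt //; last lia.
  by apply: (@lattice_map H A) => // a _; exact: lattice_coord.
Qed.

Lemma lift_dd i u : lift_ob A i u -> lift_d (i + 1) (lift_d i u) = 0.
Proof.
case: (positionP i) => [lt_ij|eq_ij|->|lt_ji].
- move=> _; rewrite lift_d_lt //; by case: (resolution_in_syzygy u lt_ij).
- move=> _; have [_ _] := resolution_in_kernel u eq_ij.
  by rewrite eq_ij lift_d_eq.
- rewrite lift_ob_eq lift_d_eq lift_d_gt; last lia.
  move=> [uA _]; rewrite /combination linear_sum big1 // => a _.
  have [z dz ->] := mN (ltn_ord a).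
  by rewrite linearZ /= coord_dE // dz (coord0 db) scaler0.
- rewrite lift_ob_gt // (@lift_d_gt i) // (@lift_d_gt (i + 1)); last lia.
  by move=> /(coord_lattice db)->; rewrite !coord_dE // cx_dd (coord0 db).
Qed.

Lemma lift_exact_far i u : (i + 1 < j)%R -> corner (fun=> 1) (r (depth (i + 1))) u ->
    lift_d (i + 1) u = 0 ->
  exists2 u', corner (fun=> 1) (r (depth i)) u' & u = lift_d i u'.
Proof.
move=> ij cu; rewrite lift_d_lt // => du.
have [_ /(_ u)[|c ->]] := genS (depth (i + 1)); first by split.
have lt_ij : (i < j)%R by lia.
exists (corner_proj (fun=> 1) (r (depth i)) c).
  by apply: corner_proj_in => a; rewrite mulr1.
by rewrite lift_d_lt // combination_corner_proj ?(depthS ij) // => a _; rewrite scale1r.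
Qed.

Definition lift_subcomplex : subcomplex (col2 A U) :=
  pair_subcomplex lift_pair (fun i u => @lift_d_in A i u (or_introl erefl))
    (fun i u => @lift_d_in (conductor A) i u (or_intror erefl)) lift_dd.

Definition lift : complex E := complex_of lift_subcomplex.

Lemma lift_fgp i : fgp_on (sc_ob lift_subcomplex i).
Proof.
rewrite /=; have [lt_ij|lt_ji|->] := Order.TotalTheory.ltgtP i j.
- by rewrite !lift_ob_lt //; exact: pair_fgp_second.
- by rewrite !lift_ob_gt //; apply: lattice_fgp => a _; exact: lattice_coord.
- rewrite !lift_ob_eq; apply: lattice_fgp => a lt_aq; split=> [b|].
    by rewrite /corner_basis; case: eqP => // _; exact: rpred0.
  by apply/corner_sum/corner_basis_in.
Qed.

Lemma lift_zero i u : (j < i)%R -> (forall y : P i, y = 0) -> lift_ob A i u -> u = 0.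
Proof.
move=> lt_ji P0; rewrite lift_ob_gt // => /(coord_lattice db)->.
by rewrite [uncoord _ _ _ _]P0 (coord0 db).
Qed.

(** All terms of the lift are projective, and in low degrees it is exact, since
    each row is a resolution there. *)
Lemma Dfb_lift (N : int) :
  (forall i, (N < i)%R -> forall y : P i, y = 0) -> Dfb lift.
Proof.
move=> P0.
have X0 i (y : lift i) : (j < i)%R -> (N < i)%R -> y = 0.
  move=> lt_ji lt_Ni; have [K1 K2] := submodP y; apply: val_inj.
  have [_ _ _ K'K] := lift_pair i.
  rewrite [LHS]surjective_pairing.
  by congr (_, _); apply: (lift_zero lt_ji (P0 i lt_Ni)) => //; exact: K'K.
split; last first.
  exists lift; split; last exact: der_iso_refl.
    by move=> i; apply: submod_fgp; exact: lift_fgp.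
  exists (Num.max j N) => i lt_i y; apply: X0; lia.
exists (j - 1), (Num.max j N) => i [lt_i|lt_i] y dy; last first.
  by exists 0; rewrite linear0; apply: X0; lia.
have ij : (i + 1 < j)%R by lia.
have lt_ij : (i < j)%R by lia.
have [] := submodP y; rewrite !lift_ob_lt // => K1 K2.
have dval : pair_d lift_d (i + 1) (val y) = 0.
  exact: (@complex_of_cocycle _ _ lift_subcomplex (i + 1) y).1 dy.
have [u1 c1 E1] := lift_exact_far ij K1 (congr1 fst dval).
have [u2 c2 E2] := lift_exact_far ij K2 (congr1 snd dval).
have c12 : sc_ob lift_subcomplex i (u1, u2) by rewrite /= /pair_pred !lift_ob_lt.
exists (to_submod (sc_sub lift_subcomplex i) c12); apply: val_inj.
by rewrite val_complex_of_d [LHS]surjective_pairing E1 E2.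
Qed.

(** [P] in coordinates, where everything below degree [j + 1] is replaced by the
    module of coboundaries of degree [j + 1], placed in degree [j]. *)
Definition trunc_ob (i : int) : U -> Prop :=
  if (i < j)%R then fun u => u = 0
  else if i == j then @coord_cocycle (i + 1)
  else lattice A (n i) (coord_basis i).

Definition trunc_d (i : int) (u : U) : U := if (j < i)%R then coord_d i u else u.

Lemma trunc_ob_lt i : (i < j)%R -> trunc_ob i = (fun u => u = 0).
Proof. by rewrite /trunc_ob => ->. Qed.

Lemma trunc_ob_eq : trunc_ob j = @coord_cocycle (j + 1).
Proof. by rewrite /trunc_ob eqxx; case: ifP => //; lia. Qed.

Lemma trunc_ob_gt i : (j < i)%R -> trunc_ob i = lattice A (n i) (coord_basis i).
Proof. by rewrite /trunc_ob => ?; rewrite !ifN //; lia. Qed.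

Lemma trunc_d_le i u : (i <= j)%R -> trunc_d i u = u.
Proof. by rewrite /trunc_d => ?; rewrite ifN //; lia. Qed.

Lemma trunc_d_gt i u : (j < i)%R -> trunc_d i u = coord_d i u.
Proof. by rewrite /trunc_d => ->. Qed.

Lemma trunc_sub i : @submodule (subring A) (restr A U) (trunc_ob i).
Proof.
have [lt_ij|lt_ji|->] := Order.TotalTheory.ltgtP i j.
- by rewrite trunc_ob_lt //; split=> // a u u' -> ->; rewrite scaler0 addr0.
- by rewrite trunc_ob_gt //; case: (lattice_pairP A (n i) (coord_basis i)).
- by rewrite trunc_ob_eq; exact: (coord_cocycle_submodule db).
Qed.

Lemma trunc_lin i : @lin_on (subring A) (restr A U) (restr A U) (trunc_ob i) (trunc_d i).
Proof.
move=> a u u' _ _; rewrite /trunc_d; case: ifP => // _.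
by rewrite restr_scaleE linearP.
Qed.

Lemma trunc_in i u : trunc_ob i u -> trunc_ob (i + 1) (trunc_d i u).
Proof.
case: (positionP i) => [lt_ij|eq_ij|->|lt_ji].
- by rewrite !trunc_ob_lt //= ?trunc_d_le //; lia.
- rewrite trunc_ob_lt => [->|]; last lia.
  rewrite trunc_d_le; last lia.
  by case: (trunc_sub (i + 1)).
- rewrite trunc_ob_eq trunc_d_le // trunc_ob_gt; last lia.
  by move=> [z _ ->]; exact: lattice_coord.
- rewrite trunc_d_gt // !trunc_ob_gt //; last lia.
  by move=> /(coord_lattice db)->; rewrite coord_dE //; exact: lattice_coord.
Qed.

Lemma trunc_dd i u : trunc_ob i u -> trunc_d (i + 1) (trunc_d i u) = 0.
Proof.
case: (positionP i) => [lt_ij|eq_ij|->|lt_ji].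
- by rewrite trunc_ob_lt => [->|]; rewrite ?trunc_d_le //; lia.
- by rewrite trunc_ob_lt => [->|]; rewrite ?trunc_d_le //; lia.
- rewrite trunc_ob_eq (@trunc_d_le j) // trunc_d_gt; last lia.
  by move=> [z dz ->]; rewrite coord_dE // dz (coord0 db).
- rewrite trunc_ob_gt // (@trunc_d_gt i) // (@trunc_d_gt (i + 1)); last lia.
  by move=> /(coord_lattice db)->; rewrite !coord_dE // cx_dd (coord0 db).
Qed.

Definition trunc : subcomplex (restr A U) :=
  Subcomplex trunc_sub trunc_lin trunc_in trunc_dd.

Lemma trunc_cocycle_le i u : (i + 1 <= j)%R -> trunc_d (i + 1) u = 0 -> u = 0.
Proof. by move=> le_ij; rewrite trunc_d_le. Qed.

Definition from_P (i : int) (y : P i) : restr A U :=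
  if (j < i)%R then coord y else if i == j then coord (cx_d P i y) else 0.

Lemma from_P_gt i (y : P i) : (j < i)%R -> from_P y = coord y.
Proof. by rewrite /from_P => ->. Qed.

Lemma from_P_linear i : linear (@from_P i).
Proof.
move=> a y y'; rewrite /from_P; case: ifP => _; first exact: (coord_linear db).
case: ifP => _; last by rewrite scaler0 addr0.
by rewrite linearP; exact: (coord_linear db).
Qed.

Lemma from_P_in i (y : P i) : trunc_ob i (from_P y).
Proof.
rewrite /from_P; case: ifP => [lt_ji|nlt_ji].
  by rewrite trunc_ob_gt //; exact: lattice_coord.
case: ifP => [eq_ij|ne]; last by case: (trunc_sub i).
rewrite /trunc_ob eq_ij ifN; last lia.
by exists (cx_d P i y) => //; exact: cx_dd.
Qed.

Lemma from_P_d i (y : P i) : from_P (cx_d P i y) = trunc_d i (from_P y).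
Proof.
rewrite {2}/from_P; case: ifP => [lt_ji|nlt_ji].
  by rewrite from_P_gt ?trunc_d_gt ?coord_dE //; lia.
rewrite trunc_d_le; last lia.
case: ifP => [/eqP E|ne]; first by rewrite from_P_gt //; lia.
rewrite /from_P ifN; last lia.
by case: ifP => // _; rewrite cx_dd (coord0 db).
Qed.

(** The cut off part of [P] is exact. *)
Lemma der_iso_P_trunc : der_iso P (complex_of trunc).
Proof.
apply: (@der_iso_map _ _ _ (@cm_into _ _ trunc P from_P
  from_P_linear from_P_in from_P_d)).
apply: quasi_iso_into => /= i.
  move=> y dy; have [/exactP ex|lt_ji] := Order.TotalTheory.leP i j.
    by move=> _; exact: ex.
  move=> [u]; rewrite trunc_ob_gt // trunc_d_gt // from_P_gt; last lia.
  move=> /(coord_lattice db)->; rewrite coord_dE // => Ey.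
  by eexists; rewrite -[LHS](coordK db) Ey coordK.
move=> u; have [le_ij _ du|lt_ji] := Order.TotalTheory.leP (i + 1) j.
  exists 0; rewrite linear0; split=> //; exists 0; first by case: (trunc_sub i).
  rewrite (trunc_cocycle_le le_ij du) trunc_d_le; last lia.
  by rewrite (linear_zero (@from_P_linear _)) addr0.
rewrite trunc_ob_gt // trunc_d_gt // => /(coord_lattice db)->.
set y := uncoord _ _ _ _; rewrite coord_dE // => dy; exists y; split.
  by rewrite -[LHS](coordK db) dy -[RHS](coordK db) (coord0 db).
exists 0; first by case: (trunc_sub i).
rewrite from_P_gt // /trunc_d; case: ifP => _; first by rewrite linear0 addr0.
by rewrite addr0.
Qed.

Definition lift_first : subcomplex (restr A U) := first_subcomplex lift_pair
  (fun i u => @lift_d_in A i u (or_introl erefl)) lift_dd.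

Notation EC := (complex_of lift_first).

Definition from_lift_fun (i : int) (u : U) : U :=
  if (j < i)%R then u else if i == j then combination q m u else 0.

Definition from_lift (i : int) (y : EC i) : restr A U := from_lift_fun i (val y).

Lemma from_lift_fun_gt i u : (j < i)%R -> from_lift_fun i u = u.
Proof. by rewrite /from_lift_fun => ->. Qed.

Lemma from_lift_fun_eq u : from_lift_fun j u = combination q m u.
Proof. by rewrite /from_lift_fun eqxx ifN //; lia. Qed.

Lemma from_lift_fun_lt i u : (i < j)%R -> from_lift_fun i u = 0.
Proof. by rewrite /from_lift_fun => ?; rewrite !ifN //; lia. Qed.

Lemma from_lift_linear i : linear (@from_lift i).
Proof.
move=> a y y'; rewrite /from_lift /from_lift_fun submod_val_lin.
case: ifP => // _; case: ifP => _; last by rewrite scaler0 addr0.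
by rewrite restr_scaleE linearP.
Qed.

Lemma from_lift_fun_in i u : lift_ob A i u -> trunc_ob i (from_lift_fun i u).
Proof.
have [lt_ij|lt_ji|->] := Order.TotalTheory.ltgtP i j.
- by rewrite trunc_ob_lt // from_lift_fun_lt.
- by rewrite lift_ob_gt // trunc_ob_gt // from_lift_fun_gt.
rewrite lift_ob_eq trunc_ob_eq from_lift_fun_eq => -[uA _].
apply: (submodule_sum (coord_cocycle_submodule db (j + 1))) => a _.
rewrite -[u a](@to_subringK _ A) //.
by apply: (submoduleZ (coord_cocycle_submodule db (j + 1))); exact: mN.
Qed.

Lemma from_lift_in i (y : EC i) : trunc_ob i (from_lift y).
Proof. by apply: from_lift_fun_in; exact: (submodP y). Qed.

Lemma from_lift_fun_d i u : lift_ob A i u ->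
  from_lift_fun (i + 1) (lift_d i u) = trunc_d i (from_lift_fun i u).
Proof.
case: (positionP i) => [lt_ij|eq_ij|->|lt_ji].
- by move=> _; rewrite !from_lift_fun_lt // ?trunc_d_le //; lia.
- move=> _; have [_ _ E0] := resolution_in_kernel u eq_ij.
  rewrite {1}eq_ij from_lift_fun_eq E0 from_lift_fun_lt ?trunc_d_le //; lia.
- by move=> _; rewrite from_lift_fun_eq lift_d_eq from_lift_fun_gt ?trunc_d_le //; lia.
- by move=> _; rewrite !from_lift_fun_gt ?lift_d_gt ?trunc_d_gt //; lia.
Qed.

Lemma from_lift_d i (y : EC i) : from_lift (cx_d EC i y) = trunc_d i (from_lift y).
Proof.
by rewrite /from_lift val_complex_of_d /= from_lift_fun_d //; exact: (submodP y).
Qed.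

Lemma from_lift_inj i u : lift_ob A (i + 1) u -> lift_d (i + 1) u = 0 ->
    (exists2 w, trunc_ob i w & from_lift_fun (i + 1) u = trunc_d i w) ->
  exists2 u', lift_ob A i u' & u = lift_d i u'.
Proof.
case: (positionP i) => [lt_ij|eq_ij|->|lt_ji].
- rewrite lift_ob_lt // => cu du _; rewrite lift_ob_lt; last lia.
  exact: lift_exact_far.
- rewrite {1 2}eq_ij lift_ob_eq lift_d_eq => -[uA /corner_lattice cu] du _.
  have [_ /(_ u)[|c ->]] := gen0; first by apply: kerJ => //; exact: cu.
  exists (corner_proj (fun=> 1) (r 0) c).
    rewrite lift_ob_lt ?(depth0 eq_ij); last lia.
    by apply: corner_proj_in => a; rewrite mulr1.
  rewrite lift_d_lt ?(depth0 eq_ij); last lia.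
  by rewrite combination_corner_proj // => a _; rewrite scale1r.
- move=> _ _ [w]; rewrite trunc_ob_eq trunc_d_le // from_lift_fun_gt; last lia.
  move=> /gm[c cA ->] ->.
  exists (corner_proj e q c); last by rewrite lift_d_eq combination_corner_proj.
  rewrite lift_ob_eq; split=> [a|]; last exact/corner_lattice/corner_proj_in.
  by rewrite /corner_proj; case: ifP => _; [apply: rpredM | exact: rpred0].
- move=> _ _ [w]; rewrite trunc_ob_gt // trunc_d_gt // from_lift_fun_gt; last lia.
  by move=> Kw ->; exists w; rewrite ?lift_ob_gt ?lift_d_gt.
Qed.

(** The first components of [lift] form a complex over [A] which agrees with [P]
    above degree [j] and is in the other degrees a resolution of the same module
    of coboundaries as in [P], so both map quasi-isomorphically to [trunc]. *)
Lemma der_iso_lift : der_iso (DF lift) P.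
Proof.
apply: der_iso_trans (der_iso_first_component _ _ _ _) _.
apply: der_iso_trans (der_iso_sym der_iso_P_trunc).
apply: (@der_iso_map _ _ _ (@cm_into _ _ trunc EC from_lift
  from_lift_linear from_lift_in from_lift_d)).
apply: quasi_iso_into => i.
  move=> y dy yw; have dy' := (@complex_of_cocycle _ _ lift_first (i + 1) y).1 dy.
  have [u Ku E'] := from_lift_inj (submodP y) dy' yw.
  exists (to_submod (sc_sub lift_first i) Ku); apply: val_inj.
  by rewrite (@val_complex_of_d _ _ lift_first).
move=> u; rewrite [sc_ob trunc]/= [sc_d trunc]/=.
have [le_ij _ du|lt_ji] := Order.TotalTheory.leP (i + 1) j.
  exists 0; rewrite linear0; split=> //; exists 0; first by case: (trunc_sub i).
  rewrite (trunc_cocycle_le le_ij du) trunc_d_le; last lia.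
  by rewrite (linear_zero (@from_lift_linear _)) addr0.
rewrite trunc_ob_gt // trunc_d_gt // => Ku du.
have Ku' : lift_ob A (i + 1) u by rewrite lift_ob_gt.
exists (to_submod (sc_sub lift_first (i + 1)) Ku'); split.
  by apply: (@complex_of_cocycle _ _ lift_first (i + 1) _).2; rewrite /= lift_d_gt.
exists 0; first by case: (trunc_sub i).
rewrite /from_lift /= from_lift_fun_gt // /trunc_d; case: ifP => _.
  by rewrite linear0 addr0.
by rewrite addr0.
Qed.

End Realization.

(** * Essential surjectivity and the comparison of dimensions *)

(** An object is represented by a complex [P] of projectives, which is modified
    below the degrees where its cohomology may be nonzero. *)
Theorem DF_essentially_surjective (H : pzRingType) (A : subringClosed H)
    (Y : complex (subring A)) :
  backstrom_pair A -> Dfb Y ->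
  exists X : complex (envelope A), Dfb X /\ der_iso Y (DF X).
Proof.
move=> hHA [[lo [hi exY]] [P [fgP [N P0] PY]]].
have fgpP i : fgp_on (fun _ : P i => True).
  by have [fg pr] := fgP i; exact: fgp_on_projective.
pose nn i := sval (cid (fgpP i)).
pose vv i := sval (cid (svalP (cid (fgpP i)))).
pose ph i := sval (cid (svalP (cid (svalP (cid (fgpP i)))))).
have db i : dual_basis (fun _ : P i => True) (nn i) (vv i) (ph i).
  exact: svalP (cid (svalP (cid (svalP (cid (fgpP i)))))).
pose j := lo - 1.
have exactP i : (i <= j)%R -> exact_at P i.
  move=> le_ij; apply: (exact_at_der_iso PY) => y; apply: exY; left.
  by rewrite /j in le_ij; lia.
have [q [e [m [[eA ee em] [mN kerJ gm srK]]]]] :=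
  minimal_cover hHA fgpP (coord_cocycle_submodule db (j + 1))
    (exactP j (Order.POrderTheory.lexx j)) (coord_cocycle_retract db (j + 1)).
have tameK : tame P j (minimal_kernel e q m).
  have hK := minimal_kernel_submodule e q m.
  split=> //; exists (minimal_kernel e q m); split=> //.
    exact: stable_retract_refl.
  by exists j.
have [r [x [gen0 genS]]] := tame_resolution hHA fgpP exactP tameK.
exists (lift hHA db mN gen0 genS); split.
  exact: Dfb_lift P0.
apply: der_iso_trans (der_iso_sym PY) _; apply: der_iso_sym.
exact: der_iso_lift.
Qed.

Theorem proposition3p2 (H : pzRingType) (A : subringClosed H)
    (hHA : backstrom_pair A)
    (* DF restricts to a functor from D_f^b of the envelope to D_f^b(A), as is
       implicit in the formation of <DF(M)> inside D_f^b(A). *)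
    (hDF : forall X : complex (envelope A), Dfb X -> Dfb (DF X)) :
  (forall n : nat, der_dim_is (envelope A) n ->
     exists m : nat, der_dim_is (subring A) m /\ (m <= n)%N) /\
  (forall (M : complex (envelope A) -> Prop) (k : nat),
     generates (@Dfb (envelope A)) M k ->
     generates (@Dfb (subring A)) (DF_image M) k).
Proof.
have genDF (M : complex (envelope A) -> Prop) k :
    generates (@Dfb (envelope A)) M k ->
    generates (@Dfb (subring A)) (DF_image M) k.
  move=> [MT genM]; split=> [_ [X [MX ->]]|Y]; first exact/hDF/MT.
  split=> [|TY]; first exact: gen_succ_sub.
  have [X [/genM gX YX]] := DF_essentially_surjective hHA TY.
  apply: (gen_succ_iso (@Dfb_zero _) TY YX).
  by apply: (gen_succ_DF hDF) gX => X' MX'; exists X'.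
split=> // n [[l [M /genDF gM]] _].
have fgn : `[< finitely_generated_at (@Dfb (subring A)) n >].
  apply/asboolP; exists l, (fun i => DF (M i)); congr (generates _ _ n): gM.
  apply/funext => Y; apply/propext; split=> [[X [[i ->] ->]]|[i ->]].
    by exists i.
  by exists (M i); split=> //; exists i.
have ex : exists k, `[< finitely_generated_at (@Dfb (subring A)) k >] by exists n.
exists (ex_minn ex); case: ex_minnP => k /asboolP fgk kmin; split; last exact: kmin.
by split=> // i fgi; apply: kmin; apply/asboolP.
Qed.
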